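(* Suppose $E:\mathcal{P}_{2,\omega_0}(\mathbb{R}^d)\to\mathbb{R}\cup\{+\infty\}$ satisfies the domain assumption (every $\mu\in D(E)$ does not charge small sets) and is proper, coercive, lower semicontinuous and $\lambda$-convex along generalized geodesics for some $\lambda\in\mathbb{R}$. Then for $\mu\in D(E)$ and $0<h\le\tau<\frac1{\lambda^-}$, $$J_\tau\mu=J_h\Big[\Big(\tfrac{\tau-h}{\tau}\mathbf{t}_\mu^{J_\tau\mu}+\tfrac h\tau\mathrm{id}\Big)\#\mu\Big].$$
   Context: Fix a probability measure $\omega_0$ on $\mathbb{R}^d$. $W_2$ is the quadratic Wasserstein distance, $\Gamma_0(\mu,\nu)$ the optimal couplings; $\mathcal{P}_{2,\omega_0}(\mathbb{R}^d)=\{\mu:W_2(\mu,\omega_0)<\infty\}$; $\#$ push-forward, $\mathrm{id}$ identity. A measure does not charge small sets if it gives zero mass to sets of finite $(d-1)$-dimensional Hausdorff measure; then for $\nu$ with $W_2(\mu,\nu)<\infty$ there is a $\mu$-a.e. unique optimal transport map $\mathbf{t}_\mu^\nu$ with $\mathbf{t}_\mu^\nu\#\mu=\nu$ and $W_2(\mu,\nu)=\|\mathrm{id}-\mathbf{t}_\mu^\nu\|_{L^2(\mu)}$. A transport plan from $\mu_0$ to $\mu_1$ with base $\omega$ is $\boldsymbol\omega\in\mathcal{P}((\mathbb{R}^d)^3)$ with $\pi^{1,2}\#\boldsymbol\omega\in\Gamma_0(\omega,\mu_0)$, $\pi^{1,3}\#\boldsymbol\omega\in\Gamma_0(\omega,\mu_1)$;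 generalized geodesic $\mu_\alpha=((1-\alpha)\pi^2+\alpha\pi^3)\#\boldsymbol\omega$; $W_{2,\boldsymbol\omega}(\mu_0,\mu_1)=(\int|x_2-x_3|^2d\boldsymbol\omega)^{1/2}$. $D(E)=\{E<\infty\}$; proper: $D(E)\ne\emptyset$; coercive: $\exists\tau_0>0,u_0$ with $\inf_v\{\frac1{2\tau_0}W_2^2(u_0,v)+E(v)\}>-\infty$; lower semicontinuous w.r.t. $W_2$; $\lambda$-convex along generalized geodesics: for all $\mu_0,\mu_1,\omega$ there is a generalized geodesic from $\mu_0$ to $\mu_1$ with base $\omega$ (induced by some $\boldsymbol\omega$) with $E(\mu_\alpha)\le(1-\alpha)E(\mu_0)+\alpha E(\mu_1)-\alpha(1-\alpha)\frac\lambda2W^2_{2,\boldsymbol\omega}(\mu_0,\mu_1)$. $\lambda^-=\max\{0,-\lambda\}$, $1/\lambda^-=+\infty$ if $\lambda^-=0$. $J_\tau\mu=\operatorname{argmin}_\nu\{\frac1{2\tau}W_2^2(\mu,\nu)+E(\nu)\}$ (well defined for $\mu$ in the $W_2$-closure of $D(E)$ and $0<\tau<1/\lambda^-$). *)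

(* Defs.v *)
From HB Require Import structures.
From mathcomp Require Import all_boot all_order all_algebra.
From mathcomp Require Import all_classical all_reals all_analysis.
Import Order.TTheory GRing.Theory Num.Theory.
Import numFieldNormedType.Exports.

Set Implicit Arguments.
Unset Strict Implicit.
Unset Printing Implicit Defensive.

Local Open Scope classical_set_scope.
Local Open Scope ring_scope.

Section Wasserstein.
Variables (R : realType) (d : nat).

Definition Rd : Type := g_sigma_algebraType (@open 'rV[R]_d).
Definition vec (x : Rd) : 'rV[R]_d := x.
Definition of_vec (v : 'rV[R]_d) : Rd := v.

Definition sqdist (x y : Rd) : R := \sum_(i < d) (vec x 0 i - vec y 0 i) ^+ 2.

Definition prob := probability Rd R.
Definition prob2 := probability (Rd * Rd)%type R.
Definition prob3 := probability (Rd * Rd * Rd)%type R.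

Local Open Scope ereal_scope.

Definition meq (mu nu : prob) : Prop :=
  forall A : set Rd, measurable A -> mu A = nu A.

Definition is_pushforward d1 d2 (T1 : measurableType d1) (T2 : measurableType d2)
  (m : set T1 -> \bar R) (f : T1 -> T2) (n : set T2 -> \bar R) : Prop :=
  forall A : set T2, measurable A -> n A = m (f @^-1` A).

Definition coupling (mu nu : prob) (g : prob2) : Prop :=
  forall A : set Rd, measurable A ->
    g (A `*` setT) = mu A /\ g (setT `*` A) = nu A.

Definition cost (g : prob2) : \bar R := \int[g]_z (sqdist z.1 z.2)%:E.

Definition W2sq (mu nu : prob) : \bar R :=
  ereal_inf [set cost g | g in [set g : prob2 | coupling mu nu g]].

Definition opt_coupling (mu nu : prob) (g : prob2) : Prop :=
  coupling mu nu g /\ cost g = W2sq mu nu.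

Definition P2 (omega0 mu : prob) : Prop := W2sq mu omega0 < +oo.

(** transport plan from mu0 to mu1 with base om (triples are ((x1,x2),x3)) *)
Definition transport_plan (om mu0 mu1 : prob) (w : prob3) : Prop :=
  (exists g : prob2, is_pushforward w (fun z => (z.1.1, z.1.2)) g /\
                     opt_coupling om mu0 g) /\
  (exists g : prob2, is_pushforward w (fun z => (z.1.1, z.2)) g /\
                     opt_coupling om mu1 g).

Definition interp (a : R) (z : (Rd * Rd * Rd)%type) : Rd :=
  of_vec ((1 - a)%R *: vec z.1.2 + a *: vec z.2).

Definition plan_W2sq (w : prob3) : \bar R := \int[w]_z (sqdist z.1.2 z.2)%:E.

(** Hausdorff measure (unnormalized) of integer dimension s *)
Definition diam (A : set Rd) : \bar R :=
  ereal_sup [set r | exists x y, A x /\ A y /\ r = (Num.sqrt (sqdist x y))%:E].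

Definition cover_term (s : nat) (C : set Rd) : \bar R :=
  if `[< C = set0 >] then 0 else ((fine (diam C)) ^+ s)%:E.

Definition hausdorff_delta (s : nat) (delta : R) (A : set Rd) : \bar R :=
  ereal_inf [set \sum_(0 <= n <oo) cover_term s (C n) | C in
    [set C : nat -> set Rd | A `<=` \bigcup_n C n /\
                             forall n, diam (C n) <= delta%:E]].

Definition hausdorff (s : nat) (A : set Rd) : \bar R :=
  ereal_sup [set hausdorff_delta s delta A | delta in [set delta : R | (0 < delta)%R]].

Definition no_small_charge (mu : prob) : Prop :=
  forall A : set Rd, measurable A -> hausdorff d.-1 A < +oo -> mu A = 0.

Variables (omega0 : prob) (E : prob -> \bar R).

Definition dom_assumption : Prop :=
  forall mu, P2 omega0 mu -> E mu < +oo -> no_small_charge mu.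

Definition proper_functional : Prop :=
  exists mu, P2 omega0 mu /\ E mu < +oo.

Definition coercive : Prop :=
  exists tau0 : R, (0 < tau0)%R /\ exists u0 : prob, P2 omega0 u0 /\
    -oo < ereal_inf [set ((2 * tau0)^-1)%:E * W2sq u0 v + E v |
                     v in [set v | P2 omega0 v]].

Definition W2_lsc : Prop :=
  forall (u : nat -> prob) (mu : prob), P2 omega0 mu ->
    (forall n, P2 omega0 (u n)) ->
    (fun n => W2sq (u n) mu) @ \oo --> 0 ->
    E mu <= limn_einf (fun n => E (u n)).

Definition convex_gen_geod (lam : R) : Prop :=
  forall mu0 mu1 om : prob,
    P2 omega0 mu0 -> P2 omega0 mu1 -> P2 omega0 om ->
    exists w : prob3, transport_plan om mu0 mu1 w /\
      forall a : R, (0 <= a)%R -> (a <= 1)%R ->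
        forall mua : prob, is_pushforward w (interp a) mua ->
          E mua <= ((1 - a)%R)%:E * E mu0 + a%:E * E mu1
                   - (a * (1 - a) * lam / 2)%R%:E * plan_W2sq w.

Definition is_prox (tau : R) (mu nu : prob) : Prop :=
  P2 omega0 nu /\
  forall nu' : prob, P2 omega0 nu' ->
    ((2 * tau)^-1)%:E * W2sq mu nu + E nu <=
    ((2 * tau)^-1)%:E * W2sq mu nu' + E nu'.

End Wasserstein.

Section Maps.
Variables (R : realType) (d : nat).
Local Open Scope ereal_scope.

Definition ot_map (mu nu : prob R d) (t : Rd R d -> Rd R d) : Prop :=
  measurable_fun setT t /\ is_pushforward mu t nu /\
  \int[mu]_x (sqdist x (t x))%:E = W2sq mu nu.

Definition step_map (tau h : R) (t : Rd R d -> Rd R d) (x : Rd R d) : Rd R d :=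
  of_vec (((tau - h) / tau)%R *: vec (t x) + (h / tau)%R *: vec x).

Definition lam_minus (lam : R) : R := Num.max 0%R (- lam)%R.
End Maps.

(* Main.v *)
Require Import Defs.
From HB Require Import structures.
From mathcomp Require Import all_boot all_order all_algebra.
From mathcomp Require Import all_classical all_reals all_analysis.
From mathcomp Require Import measurable_realfun ring lra.
Import Order.TTheory GRing.Theory Num.Theory.
Import numFieldNormedType.Exports.
Local Open Scope classical_set_scope.
Local Open Scope ring_scope.

Set Implicit Arguments.
Unset Strict Implicit.
Unset Printing Implicit Defensive.

(** An optimal plan is monotone: resampling two independent points and
    exchanging their targets whenever this is cheaper would lower the cost.  The
    points where a closed monotone relation is multivalued lie in countably many
    Lipschitz graphs of dimension [d - 1], so over a measure not charging small
    sets optimal plans are carried by graphs of maps, and these maps are unique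
    because mixtures of optimal plans are optimal.

    Over the base [mu], convexity along generalized geodesics thus becomes
    convexity along interpolations of maps in [L^2(mu)].  Coercivity and the
    geodesics issuing from [mu] bound [W_2^2(mu, .) / (2 tau) + E] from below;
    its uniform convexity makes the optimal maps of a minimizing sequence Cauchy
    in [L^2(mu)], and lower semicontinuity gives the unique minimizer [m].

    With [nu] the point dividing the geodesic from [mu] to [m], the triangle
    inequality [W_2(mu, .) <= W_2(mu, nu) + W_2(nu, .)], squared with weights
    [(tau - h) / tau] and [h / tau], shows that [m] minimizes the [h]-problem
    from [nu] and that any such minimizer minimizes the [tau]-problem from [mu].
    The gluing of plans needed for the triangle inequality is part of the
    convexity hypothesis. *)

(** * Borel structure of [R^n] by coordinates *)

Section borel.
Context {R : realType} {n : nat}.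
Notation V := 'rV[R]_n.
Notation X := (Rd R n).

(** Balls of the matrix norm are cubes, so membership is a condition on each coordinate. Rational
    centres and radii [1/(k+1)] keep the family countable. *)
Definition rat_ball (q : 'rV[rat]_n) (k : nat) : set V :=
  ball (map_mx ratr q : V) (k.+1%:R^-1).

Lemma rat_ballE (q : 'rV[rat]_n) k (x : V) :
  rat_ball q k x <-> forall i, `|ratr (q 0 i) - x 0 i| < k.+1%:R^-1.
Proof.
split=> [[_ H] i|H].
  by have := H 0 i; rewrite mxE.
by split=> // i j; rewrite ord1 mxE; exact: H.
Qed.

Lemma rat_ball_dense (x : V) k : exists q, rat_ball q k x.
Proof.
have H i : exists q : rat, `|ratr q - x 0 i| < k.+1%:R^-1.
  have [q] : exists q : rat, ratr q \in
      `](x 0 i - k.+1%:R^-1), (x 0 i + k.+1%:R^-1)[.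
    by apply: rat_in_itvoo; rewrite ltrBlDr -addrA ltrDl addr_gt0.
  by rewrite in_itv/= -ltr_distl => ?; exists q.
have [f fP] := choice H.
by exists (\row_i f i); apply/rat_ballE => i; rewrite mxE.
Qed.

Lemma rat_ball_sub (x : V) k (e : R) q : 2 * k.+1%:R^-1 <= e ->
  rat_ball q k x -> rat_ball q k `<=` ball x e.
Proof.
move=> ke /rat_ballE qx y /rat_ballE qy; split.
  by apply: lt_le_trans ke; rewrite mulr_gt0.
move=> i j; rewrite ord1; apply: lt_le_trans ke.
have := ler_distD (ratr (q 0 j)) (x 0 j) (y 0 j).
move: (qx j) (qy j); rewrite (distrC _ (x 0 j)) => /= a b c.
by apply: (le_lt_trans c); rewrite mulr_natl mulr2n ltrD.
Qed.

Lemma small_nat (e : R) : 0 < e -> exists k : nat, 2 * k.+1%:R^-1 <= e.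
Proof.
move=> e0; have e20 : 0 < e / 2 by rewrite divr_gt0.
have [k _ H] := near_infty_natSinv_lt (PosNum e20).
exists k; have /= := H k (leqnn _).
by move: (k.+1%:R^-1) => u; lra.
Qed.

Lemma open_rd_measurable (U : set V) : open U -> measurable (U : set X).
Proof. by move=> oU; exact: sub_sigma_algebra. Qed.

Lemma closed_rd_measurable (U : set V) : closed U -> measurable (U : set X).
Proof.
move=> cU; rewrite -(setCK U); apply: measurableC; apply: open_rd_measurable.
exact: closed_openC.
Qed.

Lemma measurable_coord i : measurable_fun setT (fun x : X => vec x 0 i).
Proof.
apply: (measurability (@RGenOInfty.G R)); first exact: RGenOInfty.measurableE.
move=> _ [_ [a ->] <-].
rewrite setTI; apply: open_rd_measurable.
apply: (@open_comp V R (fun x : V => x 0 i)); first by move=> x _; exact: coord_continuous.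
exact: interval_open.
Qed.

Lemma open_rat_ball (q : 'rV[rat]_n) k : open (rat_ball q k).
Proof. exact: ball_open. Qed.

Lemma measurable_rat_ball q k : measurable (rat_ball q k : set X).
Proof. by apply: open_rd_measurable; exact: open_rat_ball. Qed.

(** An open set is the union of the countably many rational cubes inside it, and the preimage of a
    cube is a finite intersection of conditions on coordinates. *)
Lemma measurable_to_rd d0 (T : measurableType d0) (f : T -> X) :
  (forall i, measurable_fun setT (fun x => vec (f x) 0 i)) ->
  measurable_fun setT f.
Proof.
move=> mf; apply: (measurability (@open V : set (set X))) => // _ [U oU <-].
rewrite setTI.
have -> : f @^-1` U = \bigcup_(p : 'rV[rat]_n * nat)
    (f @^-1` (if `[< rat_ball p.1 p.2 `<=` U >] then rat_ball p.1 p.2 else set0)).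
  apply/seteqP; split=> [x Ux|x [p _]] /=; last first.
    by case: asboolP => // + ?; apply.
  have /nbhs_ballP[e /= e0 eU] : nbhs (f x : V) U by exact: open_nbhs_nbhs.
  have [k ke] := small_nat e0; have [q qx] := rat_ball_dense (f x) k.
  exists (q, k) => //=; case: asboolP => // -[].
  exact/(subset_trans _ eU)/rat_ball_sub.
apply: countable_bigcupT_measurable; first exact: countableP.
move=> [q k] /=; case: asboolP => _; last by rewrite preimage_set0.
have -> : f @^-1` (rat_ball q k) = \bigcap_(i in [set: 'I_n])
    ((fun x => `|ratr (q 0 i) - vec (f x) 0 i|) @^-1` `]-oo, k.+1%:R^-1[).
  apply/seteqP; split=> [x /rat_ballE H i _|x H] /=; first by rewrite in_itv/=.
  by apply/rat_ballE => i; have := H i I; rewrite /= in_itv/=.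
apply: fin_bigcap_measurable => // i _.
rewrite -[X in measurable X]setTI.
suff : measurable_fun setT (fun x => `|ratr (q 0 i) - vec (f x) 0 i|) by exact.
apply: measurableT_comp => //; apply: measurable_funB => //.
Qed.

Lemma measurable_sqdist d0 (T : measurableType d0) (f g : T -> X) :
  measurable_fun setT f -> measurable_fun setT g ->
  measurable_fun setT (fun x => sqdist (f x) (g x)).
Proof.
move=> mf mg; apply: measurable_sum => i; apply: measurable_funX.
by apply: measurable_funB; [exact: (measurableT_comp (measurable_coord i) mf)|
  exact: (measurableT_comp (measurable_coord i) mg)].
Qed.

Lemma measurable_sqdistE d0 (T : measurableType d0) (f g : T -> X) :
  measurable_fun setT f -> measurable_fun setT g ->
  measurable_fun setT (fun x => (sqdist (f x) (g x))%:E).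
Proof. by move=> mf mg; apply/measurable_EFinP; exact: measurable_sqdist. Qed.

Lemma measurable_comb d0 (T : measurableType d0) (a b : R) (f g : T -> X) :
  measurable_fun setT f -> measurable_fun setT g ->
  measurable_fun setT (fun x => of_vec (a *: vec (f x) + b *: vec (g x))).
Proof.
move=> mf mg; apply: measurable_to_rd => i.
under eq_fun do rewrite /vec /of_vec !mxE.
apply: measurable_funD; apply: measurable_funM => //.
- exact: (measurableT_comp (measurable_coord i) mf).
- exact: (measurableT_comp (measurable_coord i) mg).
Qed.

Lemma sqdist_ge0 (x y : X) : 0 <= sqdist x y.
Proof. by apply: sumr_ge0 => i _; exact: sqr_ge0. Qed.

Lemma sqdist_sym (x y : X) : sqdist x y = sqdist y x.
Proof. by apply: eq_bigr => i _; rewrite -sqrrN opprB. Qed.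

Lemma sqdistxx (x : X) : sqdist x x = 0.
Proof. by rewrite /sqdist big1// => i _; rewrite subrr expr0n. Qed.

Lemma sqdist_eq0 (x y : X) : sqdist x y = 0 -> x = y.
Proof.
move=> /eqP; rewrite psumr_eq0 => [/allP H|i _]; last exact: sqr_ge0.
apply/rowP => i; have /= := H i (mem_index_enum _).
by rewrite sqrf_eq0 subr_eq0 => /eqP.
Qed.

(** Coordinatewise, the gap between the two sides is the square of [t * (a - b) - s * (b - c)]
    divided by [s * t]. This form of the triangle inequality needs no square roots. *)
Lemma sqdist_triangle (s t : R) (x y z : X) : 0 < s -> 0 < t -> s + t = 1 ->
  sqdist x z <= s^-1 * sqdist x y + t^-1 * sqdist y z.
Proof.
move=> s0 t0 st; rewrite /sqdist !mulr_sumr -big_split/=.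
apply: ler_sum => i _.
set a := vec x 0 i; set b := vec y 0 i; set c := vec z 0 i.
have -> : s^-1 * (a - b) ^+ 2 + t^-1 * (b - c) ^+ 2 =
    (a - c) ^+ 2 + (s * t)^-1 * (t * (a - b) - s * (b - c)) ^+ 2.
  have -> : t = 1 - s by lra.
  by field; rewrite (lt0r_neq0 s0) /= andbT; apply/eqP; lra.
by rewrite lerDl mulr_ge0 ?sqr_ge0// invr_ge0 mulr_ge0 ?ltW.
Qed.

Lemma sqdist_comb (a : R) (x y z : X) :
  sqdist x (of_vec ((1 - a) *: vec y + a *: vec z)) =
  (1 - a) * sqdist x y + a * sqdist x z - a * (1 - a) * sqdist y z.
Proof.
rewrite /sqdist !mulr_sumr -big_split/= -sumrB.
by apply: eq_bigr => i _; rewrite /of_vec /vec !mxE; ring.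
Qed.
End borel.

(** * Push-forwards and couplings *)

Section pushforward.
Context {R : realType} {d1 d2 d3 : measure_display}.
Context {T1 : measurableType d1} {T2 : measurableType d2} {T3 : measurableType d3}.
Local Open Scope ereal_scope.

Lemma pushforward_exists (P : probability T1 R) (f : T1 -> T2) :
  measurable_fun setT f -> exists n : probability T2 R, is_pushforward P f n.
Proof.
move=> mf; pose f' : {mfun T1 >-> T2} := mfun_Sub (mem_set mf).
by exists (distribution P f').
Qed.

Lemma ge0_integral_is_pushforward (P : probability T1 R) (f : T1 -> T2)
    (n : probability T2 R) (k : T2 -> \bar R) :
  measurable_fun setT f -> is_pushforward P f n ->
  measurable_fun setT k -> (forall x, 0 <= k x) ->
  \int[n]_x k x = \int[P]_x k (f x).
Proof.
move=> mf fn mk k0; pose f' : {mfun T1 >-> T2} := mfun_Sub (mem_set mf).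
rewrite (eq_measure_integral (distribution P f')); last by move=> A mA _; exact: fn.
by rewrite /distribution ge0_integral_pushforward.
Qed.

Lemma is_pushforward_comp (P : set T1 -> \bar R) (f : T1 -> T2) (g : T2 -> T3) n m :
  measurable_fun setT g ->
  is_pushforward P f n -> is_pushforward n g m -> is_pushforward P (g \o f) m.
Proof.
move=> mg fn gm A mA; rewrite (gm _ mA) fn// -[X in measurable X]setTI.
exact: mg.
Qed.

Lemma is_pushforward_ae (P : probability T1 R) (f g : T1 -> T2)
    (n : probability T2 R) : measurable_fun setT f -> measurable_fun setT g ->
  {ae P, forall x, f x = g x} -> is_pushforward P f n -> is_pushforward P g n.
Proof.
move=> mf mg fg fn A mA; rewrite (fn _ mA).
have mfA : measurable (f @^-1` A) by rewrite -[X in measurable X]setTI; exact: mf.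
have mgA : measurable (g @^-1` A) by rewrite -[X in measurable X]setTI; exact: mg.
have := integral_indic P measurableT mfA; rewrite setIT => <-.
have := integral_indic P measurableT mgA; rewrite setIT => <-.
apply: ae_eq_integral => //.
- by apply/measurable_EFinP; exact: measurable_indic.
- by apply/measurable_EFinP; exact: measurable_indic.
- by apply: filterS fg => x fg _; rewrite !indicE; congr (_%:R%:E); congr (nat_of_bool _);
    apply/idP/idP; rewrite !inE /= fg.
Qed.

Lemma ae_pushforward (P : probability T1 R) (f : T1 -> T2)
    (n : probability T2 R) (Q : T2 -> Prop) : measurable_fun setT f ->
  is_pushforward P f n -> {ae n, forall x, Q x} -> {ae P, forall x, Q (f x)}.
Proof.
move=> mf fn [N [mN N0 QN]]; exists (f @^-1` N); split.
- by rewrite -[X in measurable X]setTI; exact: mf.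
- by rewrite -fn.
- by move=> x /QN.
Qed.

End pushforward.

(** * Elementary properties of the squared Wasserstein distance *)

Section wasserstein.
Context {R : realType} {n : nat}.
Notation X := (Rd R n).
Notation P := (prob R n).
Local Open Scope ereal_scope.
Implicit Types mu nu : P.

(** The joint law of [f] and [g] is a coupling. Later upper bounds on the distance all go through
    this, with maps or plans in place of explicit couplings. *)
Lemma W2sq_le d0 (T : measurableType d0) (Q : probability T R) (f g : T -> X) mu nu :
  measurable_fun setT f -> measurable_fun setT g ->
  is_pushforward Q f mu -> is_pushforward Q g nu ->
  W2sq mu nu <= \int[Q]_x (sqdist (f x) (g x))%:E.
Proof.
move=> mf mg fmu gnu.
have mfg : measurable_fun setT (fun x => (f x, g x)) by exact: measurable_fun_pair.
have [c cP] := pushforward_exists Q mfg.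
rewrite -(@ge0_integral_is_pushforward _ _ _ _ _ Q _ c
  (fun z => (sqdist z.1 z.2)%:E) mfg cP)//.
- apply: ereal_inf_lbound; exists c => //= A mA; split.
    rewrite cP; last exact: measurableX.
    by rewrite fmu//; congr (Q _); apply/seteqP; split=> x /= => [[]|].
  rewrite cP; last exact: measurableX.
  by rewrite gnu//; congr (Q _); apply/seteqP; split=> x /= => [[]|].
- exact: measurable_sqdistE.
- by move=> x; rewrite lee_fin sqdist_ge0.
Qed.

Lemma coupling_fst mu nu (g : prob2 R n) : coupling mu nu g ->
  is_pushforward g fst mu.
Proof.
move=> gc A mA; have [<- _] := gc A mA; congr (g _).
by apply/seteqP; split=> x /= => [[]|].
Qed.

Lemma coupling_snd mu nu (g : prob2 R n) : coupling mu nu g ->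
  is_pushforward g snd nu.
Proof.
move=> gc A mA; have [_ <-] := gc A mA; congr (g _).
by apply/seteqP; split=> x /= => [[]|].
Qed.

Lemma couplingP mu nu (g : prob2 R n) :
  is_pushforward g fst mu -> is_pushforward g snd nu -> coupling mu nu g.
Proof.
move=> g1 g2 A mA; rewrite (g1 _ mA) (g2 _ mA); split; congr (g _).
  by apply/seteqP; split=> x /= => [[]|].
by apply/seteqP; split=> x /= => [[]|].
Qed.

Lemma W2sq_ge0 mu nu : 0 <= W2sq mu nu.
Proof.
apply: le_ereal_inf_tmp => _ [g _ <-]; apply: integral_ge0 => z _.
by rewrite lee_fin sqdist_ge0.
Qed.

Lemma W2sq_sym_le mu nu : W2sq mu nu <= W2sq nu mu.
Proof.
apply: le_ereal_inf_tmp => _ [g gc <-].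
apply: le_trans (W2sq_le (Q := g) (f := snd) (g := fst) _ _ _ _) _ => //.
- exact: coupling_snd gc.
- exact: coupling_fst gc.
- by under eq_integral do rewrite sqdist_sym.
Qed.

Lemma W2sq_sym mu nu : W2sq mu nu = W2sq nu mu.
Proof. by apply/eqP; rewrite eq_le !W2sq_sym_le. Qed.

Lemma W2sqxx mu : W2sq mu mu = 0.
Proof.
apply/eqP; rewrite eq_le W2sq_ge0 andbT.
apply: le_trans (W2sq_le (Q := mu) (f := id) (g := id) _ _ _ _) _ => //.
by under eq_integral do rewrite sqdistxx; rewrite integral0.
Qed.

Lemma meq_sym mu nu : meq mu nu -> meq nu mu.
Proof. by move=> H A mA; rewrite H. Qed.

Lemma meq_W2sq_le mu mu' nu : meq mu mu' -> W2sq mu nu <= W2sq mu' nu.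
Proof.
move=> H; apply: le_ereal_inf_tmp => _ [g gc <-]; apply: ereal_inf_lbound.
exists g => //= A mA; rewrite (H _ mA); exact: gc.
Qed.

Lemma meq_W2sq mu mu' nu : meq mu mu' -> W2sq mu nu = W2sq mu' nu.
Proof.
by move=> H; apply/eqP; rewrite eq_le !meq_W2sq_le//; exact: meq_sym.
Qed.

End wasserstein.

(** * Monotonicity of optimal plans *)

Section swap.
Context {R : realType} {n : nat}.
Notation X := (Rd R n).
Notation P := (prob R n).
Local Open Scope ereal_scope.

(** The inner product of the differences of sources and of targets. By [sqdist_swap], twice this
    number is the change of cost when two pairs exchange targets. *)
Definition mono (z z' : X * X) : R :=
  (\sum_(i < n) (vec z.1 0 i - vec z'.1 0 i) * (vec z.2 0 i - vec z'.2 0 i))%R.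

Lemma measurable_mono : measurable_fun setT (fun u : (X * X) * (X * X) => mono u.1 u.2).
Proof.
apply: measurable_sum => i; apply: measurable_funM; apply: measurable_funB;
  apply: (measurableT_comp (measurable_coord i)) => //; exact: measurableT_comp.
Qed.

Lemma mono_sym z z' : mono z z' = mono z' z.
Proof. by apply: eq_bigr => i _; ring. Qed.

Lemma sqdist_swap (z z' : X * X) :
  (sqdist z.1 z'.2 + sqdist z'.1 z.2 =
   sqdist z.1 z.2 + sqdist z'.1 z'.2 + 2 * mono z z')%R.
Proof.
rewrite /mono mulr_sumr -!big_split/=; apply: eq_bigr => i _; ring.
Qed.

Definition swap_map (u : (X * X) * (X * X)) : X * X :=
  (u.1.1, if (mono u.1 u.2 < 0)%R then u.2.2 else u.1.2).

Lemma measurable_mono_lt0 :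
  measurable_fun setT (fun u : (X * X) * (X * X) => (mono u.1 u.2 < 0)%R).
Proof. by apply: measurable_fun_ltr => //; exact: measurable_mono. Qed.

Lemma measurable_swap_map : measurable_fun setT swap_map.
Proof.
apply: measurable_fun_pair; first exact: measurableT_comp.
apply: measurable_fun_ifT; [exact: measurable_mono_lt0|exact: measurableT_comp|
  exact: measurableT_comp].
Qed.

(** The reflected measure agrees with the product on rectangles, which determines it. *)
Lemma product_swap (g : prob2 R n) :
  is_pushforward (g \x g) (fun u => (u.2, u.1)) (g \x g).
Proof.
have ms : measurable_fun setT (fun u : (X * X) * (X * X) => (u.2, u.1)).
  exact: measurable_fun_pair.
pose f' : {mfun _ >-> _} := mfun_Sub (mem_set ms).
move=> A mA.
apply: (@product_measure_unique _ _ _ _ _ g g (pushforward (g \x g) f')) => //.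
move=> B C mB mC; rewrite muleC -product_measure1E//.
suff -> : C `*` B = (fun u : (X * X) * (X * X) => (u.2, u.1)) @^-1` (B `*` C) by [].
by apply/seteqP; split=> -[x y] /= [].
Qed.

(* Resampling: draw two independent points of the plan and exchange their
   second coordinates whenever this lowers the cost.  The exchange condition
   is symmetric, so the marginals are unchanged. *)
Lemma opt_coupling_monotone (mu nu : P) (g : prob2 R n) :
  opt_coupling mu nu g -> W2sq mu nu < +oo ->
  (g \x g) [set u | (mono u.1 u.2 < 0)%R] = 0.
Proof.
move=> [gc gW] Woo.
pose G : probability ((X * X) * (X * X))%type R := (g \x g).
have Gfst : is_pushforward G fst g.
  move=> A mA; rewrite -[LHS]mule1 -(probability_setT g) -product_measure1E//.
  by rewrite /G; congr (_ _); apply/seteqP; split=> -[x y] /= => [[]|].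
have Gsnd : is_pushforward G snd g.
  move=> A mA; rewrite -[LHS]mul1e -(probability_setT g) -product_measure1E//.
  by rewrite /G; congr (_ _); apply/seteqP; split=> -[x y] /= => [[]|].
pose S := [set u : (X * X) * (X * X) | (mono u.1 u.2 < 0)%R].
have mS : measurable S by rewrite -[X in measurable X]setTI; exact: measurable_mono_lt0.
have msw : measurable_fun setT (fun u : (X * X) * (X * X) => (u.2, u.1)).
  exact: measurable_fun_pair.
have [g' g'P] := pushforward_exists G measurable_swap_map.
have g'c : coupling mu nu g'.
  apply: couplingP => A mA.
    rewrite g'P; last by rewrite -[X in measurable X]setTI; exact: measurable_fst.
    rewrite (coupling_fst gc mA) Gfst//.
    by rewrite -[X in measurable X]setTI; exact: measurable_fst.
  have mA2 : measurable ((snd : X * X -> X) @^-1` A).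
    by rewrite -[X in measurable X]setTI; exact: measurable_snd.
  have mA12 : measurable ((fun u : (X * X) * (X * X) => u.1.2) @^-1` A).
    rewrite -[X in measurable X]setTI.
    by apply: (measurableT_comp measurable_snd measurable_fst).
  rewrite g'P// (coupling_snd gc mA) (Gfst _ mA2).
  (* The mass is split along [S]. Off [S] no target moves; on [S], which is symmetric, reflection
     turns the exchanged event into the original one and preserves [G]. *)
  rewrite (measureDI G mA12 mS).
  rewrite [RHS](measureDI G _ mS); last first.
    by rewrite -[X in measurable X]setTI; apply: measurable_swap_map.
  congr (_ + _).
    congr (G _); apply/seteqP; split => u [] /=; rewrite /S/=.
      by move=> ? /negP/negbTE ->.
    by case: ifPn.
  rewrite (_ : (fun u : (X * X) * (X * X) => u.1.2) @^-1` A `&` S =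
    (fun u : (X * X) * (X * X) => (u.2, u.1)) @^-1`
      (swap_map @^-1` (snd @^-1` A) `&` S)); last first.
    apply/seteqP; split => u [] /=; rewrite /S/= (mono_sym u.2).
      by move=> Au m0; rewrite m0.
    by move=> + m0; rewrite m0.
  apply/esym/(@product_swap g); apply: measurableI => //.
  by rewrite -[X in measurable X]setTI; apply: measurable_swap_map.
pose c (z : X * X) : \bar R := (sqdist z.1 z.2)%:E.
have c0 z : 0 <= c z by rewrite lee_fin sqdist_ge0.
have mc : measurable_fun setT c by exact: measurable_sqdistE.
have mcs : measurable_fun setT (c \o swap_map).
  exact: (measurableT_comp mc measurable_swap_map).
have mcs' : measurable_fun setT (fun u => c (swap_map (u.2, u.1))).
  exact: (measurableT_comp mcs msw).
(* [D] is the cost saved by an exchange. Integrating [split_c] gives [2 cost g = 2 cost g' + int D];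
   since [cost g] is minimal and finite, the integral of [D] vanishes. *)
pose D u : \bar R := if (mono u.1 u.2 < 0)%R then (- (2 * mono u.1 u.2))%:E else 0.
have D0 u : 0 <= D u.
  by rewrite /D; case: ifPn => // m0; rewrite lee_fin; lra.
have mD : measurable_fun setT D.
  apply: measurable_fun_ifT => //; first exact: measurable_mono_lt0.
  apply/measurable_EFinP; apply: measurableT_comp => //.
  by apply: measurable_funM => //; exact: measurable_mono.
have split_c u : c u.1 + c u.2 = c (swap_map u) + c (swap_map (u.2, u.1)) + D u.
  rewrite /c /D /swap_map /= (mono_sym u.2).
  case: ifPn => _; rewrite -!EFinD; congr EFin; last by rewrite addr0.
  by rewrite sqdist_swap; lra.
have icg' : \int[G]_u c (swap_map u) = cost g'.
  by rewrite [RHS](ge0_integral_is_pushforward measurable_swap_map g'P).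
have icg'2 : \int[G]_u c (swap_map (u.2, u.1)) = cost g'.
  rewrite -icg'.
  by rewrite [RHS](ge0_integral_is_pushforward msw (@product_swap g) mcs (fun=> c0 _)).
have icg : \int[G]_u c u.1 = cost g.
  by rewrite [RHS](ge0_integral_is_pushforward _ Gfst).
have icg2 : \int[G]_u c u.2 = cost g.
  by rewrite [RHS](ge0_integral_is_pushforward _ Gsnd).
have cgg' : cost g <= cost g' by rewrite gW; apply: ereal_inf_lbound; exists g'.
have intD : \int[G]_u D u = 0.
  have : \int[G]_u (c u.1 + c u.2) =
      \int[G]_u (c (swap_map u) + c (swap_map (u.2, u.1)) + D u).
    by apply: eq_integral => u _; exact: split_c.
  rewrite ge0_integralD//; [|exact: (measurableT_comp mc)|exact: (measurableT_comp mc)].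
  rewrite ge0_integralD//; [|by move=> u _; exact: adde_ge0|exact: emeasurable_funD].
  rewrite ge0_integralD// icg icg2 icg' icg'2.
  have : 0 <= \int[G]_u D u by exact: integral_ge0.
  move: cgg'; have : cost g \is a fin_num.
    by rewrite gW ge0_fin_numE// W2sq_ge0.
  case: (cost g) => // r _.
  case: (cost g') => [r'| |]//; case: (\int[G]_u D u) => [s| |]//.
  by rewrite !lee_fin -!EFinD => ? ? [] ?; congr EFin; lra.
have /(ae_eq_integral_abs G measurableT mD)[N [mN N0 DN]] : \int[G]_u `|D u| = 0.
  by rewrite -[RHS]intD; apply: eq_integral => u _; rewrite gee0_abs.
apply/eqP; rewrite -measure_le0 -[leRHS]N0; apply: le_measure; rewrite ?inE//.
move=> u Su; apply: DN => /= /(_ I); rewrite /D Su /= => -[] H.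
by move: Su; rewrite /S /=; lra.
Qed.
End swap.

(** * Sets in a cone are Lipschitz graphs *)

Section cone.
Context {R : realType} {n : nat}.
Notation V := 'rV[R]_n.
Notation X := (Rd R n).

(** [A] is a Lipschitz graph over the coordinates other than [i], in the l1 norm. The inequality
    form avoids naming the function and its domain. *)
Definition in_cone (i : 'I_n) (L : R) (A : set V) : Prop :=
  forall x y, A x -> A y ->
    `|x 0 i - y 0 i| <= L * \sum_(j < n | j != i) `|x 0 j - y 0 j|.

Lemma sum_neq_const_le (i : 'I_n) (r : R) : 0 <= r ->
  \sum_(j < n | j != i) r <= n%:R * r.
Proof.
move=> r0; rewrite sumr_const -[leLHS]mulr_natl ler_wpM2r// ler_nat.
by apply: leq_trans (max_card _) _; rewrite card_ord.
Qed.

Lemma in_cone_subset i L A B : A `<=` B -> in_cone i L B -> in_cone i L A.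
Proof. by move=> AB cB x y /AB Bx /AB By; exact: cB. Qed.

(** Replacing both points by points of [A] within [r] costs [2 * r] in coordinate [i] and at most
    [n * (2 * r)] in the sum of the others, hence the factor [M]. *)
Lemma in_cone_closure i L A : 0 <= L -> in_cone i L A -> in_cone i L (closure A).
Proof.
move=> L0 cA x y clx cly; apply/ler_addgt0Pr => e e0.
pose M : R := 2 + L * (n%:R * 2).
have M0 : 0 < M by rewrite ltr_pwDl// mulr_ge0// mulr_ge0.
pose r := e / M; have r0 : 0 < r by rewrite divr_gt0.
have [a [Aa [_ xa]]] := clx _ (nbhsx_ballx x r r0).
have [b [Ab [_ yb]]] := cly _ (nbhsx_ballx y r r0).
have dj (j : 'I_n) (u v u' v' : V) : ball (u 0 j) r (u' 0 j) -> ball (v 0 j) r (v' 0 j) ->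
    `|u 0 j - v 0 j| <= `|u' 0 j - v' 0 j| + 2 * r.
  rewrite /ball/= => H1 H2.
  have -> : u 0 j - v 0 j = (u 0 j - u' 0 j) + (u' 0 j - v' 0 j) - (v 0 j - v' 0 j).
    by ring.
  apply: le_trans (ler_normB _ _) _.
  have := ler_normD (u 0 j - u' 0 j) (u' 0 j - v' 0 j).
  by move: (ltW H1) (ltW H2); lra.
apply: le_trans (dj i x y a b (xa 0 i) (yb 0 i)) _.
apply: le_trans (lerD (cA _ _ Aa Ab) (lexx _)) _.
have -> : e = r * M by rewrite /r mulfVK// lt0r_neq0.
have : \sum_(j < n | j != i) `|a 0 j - b 0 j| <=
   \sum_(j < n | j != i) `|x 0 j - y 0 j| + n%:R * (2 * r).
  apply: le_trans (_ : \sum_(j < n | j != i) (`|x 0 j - y 0 j| + 2 * r) <= _).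
    apply: ler_sum => j _; apply: (dj j a b x y); apply: ball_sym.
      exact: (xa 0 j).
    exact: (yb 0 j).
  by rewrite big_split/= lerD2l sum_neq_const_le// mulr_ge0// ltW.
move=> /(ler_wpM2l L0); rewrite /M; lra.
Qed.

(** The cone condition bounds the oscillation of coordinate [i] by [L * n * r], so all coordinates
    oscillate by at most [(1 + L * n) * r]. *)
Lemma cone_diam_bound i L (A : set V) (r : R) : 0 <= L -> in_cone i L A ->
  0 <= r ->
  (forall x y, A x -> A y -> forall j, j != i -> `|x 0 j - y 0 j| <= r) ->
  (diam (A : set X) <= (n%:R * (1 + L * n%:R) * r)%:E)%E.
Proof.
move=> L0 cA r0 rA; apply: ge_ereal_sup => _ [x [y [Ax [Ay ->]]]].
rewrite lee_fin.
pose s := (1 + L * n%:R) * r.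
have Ln0 : 0 <= L * n%:R by rewrite mulr_ge0.
have s0 : 0 <= s by rewrite mulr_ge0// addr_ge0.
have xys j : `|x 0 j - y 0 j| <= s.
  have [->|ji] := eqVneq j i; last first.
    by apply: le_trans (rA _ _ Ax Ay _ ji) _; rewrite /s mulrDl mul1r lerDl mulr_ge0.
  apply: le_trans (cA _ _ Ax Ay) _.
  apply: le_trans (_ : L * (n%:R * r) <= _); last by rewrite /s mulrDl mulrA lerDr mul1r.
  apply: ler_wpM2l => //.
  apply: le_trans (ler_sum _ (fun k ki => rA _ _ Ax Ay k ki)) _.
  exact: sum_neq_const_le.
have n1 : (1 : R) <= n%:R by rewrite ler1n (leq_ltn_trans _ (ltn_ord i)).
have -> : n%:R * (1 + L * n%:R) * r = Num.sqrt ((n%:R * s) ^+ 2).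
  by rewrite sqrtr_sqr ger0_norm; [rewrite /s mulrA|rewrite mulr_ge0].
clearbody s; apply: ler_wsqrtr.
apply: le_trans (_ : \sum_(j < n) s ^+ 2 <= _).
  by apply: ler_sum => j _; rewrite -real_normK ?num_real// lerXn2r ?nnegrE.
rewrite sumr_const card_ord -[leLHS]mulr_natl exprMn ler_wpM2r ?sqr_ge0//.
by rewrite expr2 ler_peMl// (le_trans ler01).
Qed.

Lemma diam_ge0 (A : set X) : A <> set0 -> (0 <= diam A)%E.
Proof.
move=> A0; have [x Ax] : A !=set0 by apply/set0P/eqP.
apply: ereal_sup_ubound; exists x, x; do 2 split=> //.
by rewrite sqdistxx sqrtr0.
Qed.

Lemma cover_term_ge0 (s : nat) (A : set X) : (0 <= cover_term s A)%E.
Proof.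
rewrite /cover_term; case: asboolP => // A0.
by rewrite lee_fin exprn_ge0// fine_ge0// diam_ge0.
Qed.

Lemma cover_term_le (s : nat) (A : set X) (r : R) : 0 <= r ->
  (diam A <= r%:E -> cover_term s A <= (r ^+ s)%:E)%E.
Proof.
move=> r0 Ar; rewrite /cover_term; case: asboolP => [_|A0].
  by rewrite lee_fin exprn_ge0.
have d0 := diam_ge0 A0.
rewrite lee_fin lerXn2r ?nnegrE ?fine_ge0//.
by rewrite -lee_fin fineK// fin_numElt (lt_le_trans _ d0)//= (le_lt_trans Ar)// ltry.
Qed.

(** Cutting the box of the other coordinates into [(k+1)^(n-1)] cubes cuts [A] into pieces of
    diameter at most [C0 / (k+1)]. The powers of the diameters sum to at most [C0^(n-1)], whatever
    [k] is. *)
Lemma cone_hausdorff i L (A : set V) (b : R) : 0 <= L -> in_cone i L A -> 0 < b ->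
  (forall x, A x -> forall j, - b <= x 0 j < b) ->
  (hausdorff n.-1 (A : set X) < +oo)%E.
Proof.
move=> L0 cA b0 Ab.
pose C0 : R := n%:R * (1 + L * n%:R) * (2 * b).
have C00 : 0 <= C0.
  by rewrite /C0 !mulr_ge0 ?addr_ge0 ?mulr_ge0 // ltW.
suff : (hausdorff n.-1 (A : set X) <= (C0 ^+ n.-1)%:E)%E.
  by move=> /le_lt_trans; apply; rewrite ltry.
apply: ge_ereal_sup => _ [delta /= delta0 <-].
have [k kd] : exists k : nat, C0 * k.+1%:R^-1 <= delta.
  have e0 : 0 < 2 * delta / (C0 + 1) by rewrite divr_gt0 ?mulr_gt0 ?ltr_pwDr.
  have [k] := small_nat e0; rewrite ler_pdivlMr ?ltr_pwDr// => H.
  exists k; move: H; have : 0 < k.+1%:R^-1 :> R by [].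
  by move: (k.+1%:R^-1) => u u0; nra.
pose rho := 2 * b * k.+1%:R^-1.
have rho0 : 0 < rho by rewrite !mulr_gt0.
pose piece (f : {ffun 'I_n.-1 -> 'I_k.+1}) : set X := [set x | A x /\
  forall j, rho * (f j)%:R <= vec x 0 (lift i j) + b <= rho * (f j).+1%:R].
pose T := {ffun 'I_n.-1 -> 'I_k.+1}.
(* The finitely many pieces are numbered from 0; the remaining sets are empty and contribute nothing
   to the series. *)
pose C (m : nat) : set X :=
  if insub m is Some o then piece (@enum_val T (mem T) o) else set0.
have dC m : (diam (C m) <= (C0 * k.+1%:R^-1)%:E)%E.
  rewrite /C; case: insubP => [u _ _|_]; last first.
    by apply: ge_ereal_sup => e [x [y []]].
  have -> : C0 * k.+1%:R^-1 = n%:R * (1 + L * n%:R) * rho.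
    by rewrite /C0 /rho !mulrA.
  apply: (@cone_diam_bound i) => //; first by apply: in_cone_subset cA => x [].
    exact: ltW.
  move=> x y [_ px] [_ py] j ji; case: (unliftP i j) ji => [j' ->|->]; last by rewrite eqxx.
  move=> _; move: (px j') (py j'); rewrite /vec -!natr1 !mulrDr !mulr1.
  move=> /andP[? ?] /andP[? ?]; rewrite ler_distl; apply/andP; split; lra.
apply: (@le_trans _ _ (\big[+%E/0%E]_(0 <= m <oo) cover_term n.-1 (C m))%E).
  apply: ereal_inf_lbound; exists C => //=; split; last first.
    by move=> m; apply: le_trans (dC m) _; rewrite lee_fin.
  move=> x Ax.
  have xb j : 0 <= (vec x 0 (lift i j) + b) / rho < k.+1%:R.
    have /andP[h1 h2] := Ab _ Ax (lift i j).
    rewrite divr_ge0 ?(ltW rho0)//=; last by rewrite /vec; lra.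
    rewrite ltr_pdivrMr// /rho mulrCA mulfV// mulr1 /vec; lra.
  have tb j : (Num.truncn ((vec x 0 (lift i j) + b) / rho)%R < k.+1)%N.
    by have /andP[h1 h2] := xb j; rewrite truncn_lt_nat.
  pose f : T := [ffun j => Ordinal (tb j)].
  exists (enum_rank f) => //; rewrite /C (_ : insub _ = Some (enum_rank f)); last exact: valK.
  rewrite enum_rankK; split=> // j; rewrite ffunE/=.
  have /andP[/truncn_itv/andP[h1 h2] _] := xb j.
  by rewrite ![rho * _]mulrC -ler_pdivlMr// h1/= -ler_pdivrMr// ltW.
rewrite (nneseries_split 0 #|T|); last first.
  by move=> m _; exact: cover_term_ge0.
rewrite [X in (_ + X)%E]eseries0; last first.
  move=> m mT _; rewrite /C insubF; last by rewrite add0n in mT; rewrite ltnNge mT.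
  by rewrite /cover_term; case: asboolP.
rewrite adde0 add0n.
apply: (@le_trans _ _ (\sum_(0 <= m < #|T|) ((C0 * k.+1%:R^-1) ^+ n.-1)%:E)%E).
  by apply: lee_sum => m _; apply: cover_term_le => //; rewrite mulr_ge0.
rewrite sumEFin lee_fin sumr_const_nat subn0 card_ffun !card_ord -[leLHS]mulr_natl natrX.
by rewrite -exprMn mulrCA mulfV// mulr1.
Qed.

(** [no_small_charge] speaks of measurable sets of finite Hausdorff measure, so [A] is enlarged to
    its closure, still in the cone, and cut into countably many bounded pieces. *)
Lemma cone_negligible (mu : prob R n) i L (A : set V) : no_small_charge mu ->
  0 <= L -> in_cone i L A -> mu.-negligible (A : set X).
Proof.
move=> nsc L0 cA.
pose K (m : nat) : set X :=
  [set x | closure A x /\ forall j, - m.+1%:R <= vec x 0 j < m.+1%:R].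
have mK m : measurable (K m).
  have -> : K m = (closure A : set X) `&` \bigcap_(j in [set: 'I_n])
      ((fun x : X => vec x 0 j) @^-1` [set` `[- m.+1%:R, m.+1%:R[ ]).
    apply/seteqP; split=> [x [cx xj]|x [cx xj]]; split=> // j.
      by move=> _ /=; rewrite in_itv/=; exact: xj.
    by have := xj j I; rewrite /= in_itv/=.
  apply: measurableI; first by apply: closed_rd_measurable; exact: closed_closure.
  apply: fin_bigcap_measurable => // j _; rewrite -[X in measurable X]setTI.
  by apply: measurable_coord => //; exact: measurable_itv.
apply: (@negligibleS _ _ _ _ (\bigcup_m K m)); last first.
  apply: negligible_bigcup => m; apply/negligibleP => //; apply: nsc => //.
  apply: (@cone_hausdorff i L _ m.+1%:R) => //; last by move=> x [].
  by apply: in_cone_subset (in_cone_closure L0 cA) => x [].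
move=> x Ax; exists (Num.truncn (\sum_j `|vec x 0 j|)) => //; split.
  exact: subset_closure.
move=> j; set s := \sum_j _.
have : `|vec x 0 j| <= s by rewrite /s (bigD1 j)//= lerDl sumr_ge0.
have s0 : 0 <= s by rewrite sumr_ge0.
have /andP[_ h] := truncn_itv s0.
rewrite ler_norml => /andP[h1 h2]; apply/andP; split; last exact: le_lt_trans h.
by apply: le_trans h1; rewrite lerN2 ltW.
Qed.
End cone.

(** * Optimal plans are carried by graphs *)

Lemma negligible_bigcup_countable d (T : measurableType d) (R : realType)
    (mu : {measure set T -> \bar R}) (I : countType) (F : I -> set T) :
  (forall i, mu.-negligible (F i)) -> mu.-negligible (\bigcup_i F i).
Proof.
move=> nF.
apply: (@negligibleS _ _ _ _
  (\bigcup_k (if unpickle k is Some i then F i else set0))).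
  by move=> x [i _ Fx]; exists (pickle i) => //; rewrite pickleK.
apply: negligible_bigcup => k; case: unpickle => [i|]; first exact: nF.
exact: negligible_set0.
Qed.

Section support.
Context {R : realType} {n : nat}.
Notation V := 'rV[R]_n.
Notation X := (Rd R n).
Notation P := (prob R n).
Variable g : prob2 R n.

Let null_box (b : 'rV[rat]_n * 'rV[rat]_n * nat) : set (X * X) :=
  let U := (rat_ball b.1.1 b.2 : set X) `*` (rat_ball b.1.2 b.2 : set X) in
  if g U == 0%E then U else set0.

(* The topological support, cut out by countably many null rational boxes. *)
Definition supp : set (X * X) := ~` (\bigcup_b null_box b).

Lemma supp_negligible : g.-negligible (~` supp).
Proof.
rewrite /supp setCK; apply: negligible_bigcup_countable => b.
rewrite /null_box; case: eqP => [gU0|_]; last exact: negligible_set0.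
by apply/negligibleP => //; apply: measurableX; exact: measurable_rat_ball.
Qed.

Lemma supp_pos q p k z : supp z ->
  ((rat_ball q k : set X) `*` (rat_ball p k : set X)) z ->
  g ((rat_ball q k : set X) `*` (rat_ball p k : set X)) != 0%E.
Proof.
move=> sz Uz; apply/negP => gU0; apply: sz; exists (q, p, k) => //.
by rewrite /null_box /= gU0.
Qed.

Lemma continuous_mono : continuous (fun u : (V * V) * (V * V) =>
  mono (u.1 : X * X) (u.2 : X * X)).
Proof.
have c11 (i : 'I_n) : continuous (fun u : (V * V) * (V * V) => u.1.1 0 i).
  move=> u; apply: (@continuous_comp _ _ _ (fun u => u.1.1) (fun v : V => v 0 i)).
    by apply: continuous_comp; exact: cvg_fst.
  exact: coord_continuous.
have c12 (i : 'I_n) : continuous (fun u : (V * V) * (V * V) => u.1.2 0 i).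
  move=> u; apply: (@continuous_comp _ _ _ (fun u => u.1.2) (fun v : V => v 0 i)).
    by apply: continuous_comp; [exact: cvg_fst|exact: cvg_snd].
  exact: coord_continuous.
have c21 (i : 'I_n) : continuous (fun u : (V * V) * (V * V) => u.2.1 0 i).
  move=> u; apply: (@continuous_comp _ _ _ (fun u => u.2.1) (fun v : V => v 0 i)).
    by apply: continuous_comp; [exact: cvg_snd|exact: cvg_fst].
  exact: coord_continuous.
have c22 (i : 'I_n) : continuous (fun u : (V * V) * (V * V) => u.2.2 0 i).
  move=> u; apply: (@continuous_comp _ _ _ (fun u => u.2.2) (fun v : V => v 0 i)).
    by apply: continuous_comp; exact: cvg_snd.
  exact: coord_continuous.
apply: continuous_big; first exact: add_continuous.
by move=> i _ u; apply: cvgM; apply: cvgB; [exact: c11|exact: c21|exact: c12|exact: c22].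
Qed.

(** If [mono] were negative at two support points, continuity would keep it negative on a product of
    small rational boxes around them, which has positive mass. *)
Lemma supp_monotone (z z' : X * X) :
  (g \x g)%E [set u | mono u.1 u.2 < 0] = 0%E -> supp z -> supp z' ->
  0 <= mono z z'.
Proof.
move=> S0 sz sz'; rewrite leNgt; apply/negP => m0.
have : nbhs ((z, z') : (V * V) * (V * V)) [set u | mono (u.1 : X * X) (u.2 : X * X) < 0].
  apply: (@continuous_mono (z, z') [set r | r < 0]).
  by apply: open_nbhs_nbhs; split => //; exact: open_lt.
move=> /nbhs_ballP[e /= e0 eS].
have [k ke] := small_nat e0.
have [q1 qz1] := rat_ball_dense (z.1 : V) k.
have [q2 qz2] := rat_ball_dense (z.2 : V) k.
have [q1' qz1'] := rat_ball_dense (z'.1 : V) k.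
have [q2' qz2'] := rat_ball_dense (z'.2 : V) k.
have gz : g ((rat_ball q1 k : set X) `*` (rat_ball q2 k : set X)) != 0%E.
  by apply: (supp_pos sz).
have gz' : g ((rat_ball q1' k : set X) `*` (rat_ball q2' k : set X)) != 0%E.
  by apply: (supp_pos sz').
set U := _ `*` _ in gz; set U' := _ `*` _ in gz'.
have mU : measurable U by apply: measurableX; exact: measurable_rat_ball.
have mU' : measurable U' by apply: measurableX; exact: measurable_rat_ball.
have : (g \x g)%E (U `*` U') = 0%E.
  apply/eqP; rewrite -measure_le0 -[leRHS]S0; apply: le_measure; rewrite ?inE//.
  - exact: measurableX.
  - by rewrite -[X in measurable X]setTI; exact: measurable_mono_lt0.
  move=> [[x y] [x' y']] [[/= Ux Uy] [/= Ux' Uy']].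
  apply: (eS ((x, y), (x', y'))); split; split.
  - exact: (rat_ball_sub ke qz1 Ux).
  - exact: (rat_ball_sub ke qz2 Uy).
  - exact: (rat_ball_sub ke qz1' Ux').
  - exact: (rat_ball_sub ke qz2' Uy').
rewrite product_measure1E// => /eqP; rewrite mule_eq0.
by rewrite (negbTE gz) (negbTE gz').
Qed.

(** The projection of a closed set along a compact factor is closed, by the tube lemma. It provides
    the measurable sets from which the transport map is built. *)
Lemma supp_slice_closed (B : set V) : compact B ->
  closed [set x : V | exists y : V, B y /\ supp ((x : X), (y : X))].
Proof.
move=> /compact_near_coveringP cB; rewrite -[X in closed X]setCK.
apply: open_closedC; rewrite openE => x /= nx.
have := cB V (nbhs x) (fun x' y => ~ supp (x', y)) _.
have H : forall y, B y -> \forall y' \near y & i \near nbhs x, ~ supp (i, y').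
  move=> y By.
  have : ~ supp (x, y) by move=> sxy; apply: nx; exists y.
  move=> /contrapT[[[q p] k] _]; rewrite /null_box; case: eqP => //= gU0 [/= qx py].
  exists (rat_ball p k, rat_ball q k).
    by split; apply: open_nbhs_nbhs; split => //; exact: open_rat_ball.
  move=> [y' x'] [/= py' qx']; apply; exists (q, p, k) => //.
  by rewrite /null_box /= gU0 eqxx.
move=> /(_ _ H); apply: filterS => x' Bx' [y [By sxy]].
exact: Bx' By sxy.
Qed.

Definition multi : set V := [set x | exists y y' : V,
  [/\ supp ((x : X), (y : X)), supp ((x : X), (y' : X)) & y <> y']].

Lemma sum_absM_le (a b : 'I_n -> R) (r : R) : (forall j, `|a j| <= r) ->
  `|\sum_j a j * b j| <= r * \sum_j `|b j|.
Proof.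
move=> ar; apply: le_trans (ler_norm_sum _ _ _) _; rewrite mulr_sumr.
by apply: ler_sum => j _; rewrite normrM ler_wpM2r.
Qed.

(* Two values near p and q on each side: monotonicity pins the difference
   x - x' to be almost orthogonal to q - p. *)
Lemma multi_cone (i : 'I_n) (p q : 'rV[rat]_n) k :
  (g \x g)%E [set u | mono u.1 u.2 < 0] = 0%E ->
  3 * k.+1%:R^-1 <= `|ratr (q 0 i) - ratr (p 0 i) : R| ->
  exists2 L, 0 <= L & in_cone i L [set x : V | exists y y' : V,
    [/\ supp ((x : X), (y : X)), supp ((x : X), (y' : X)),
        rat_ball p k y & rat_ball q k y']].
Proof.
move=> S0 pqk; set r : R := k.+1%:R^-1 in pqk *.
have r0 : 0 < r by rewrite invr_gt0.
pose w (j : 'I_n) : R := ratr (q 0 j) - ratr (p 0 j).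
pose M := \sum_j `|w j| + 2 * r.
have M0 : 0 <= M by rewrite addr_ge0 ?sumr_ge0// mulr_ge0// ltW.
exists (M / r); first by rewrite divr_ge0// ltW.
move=> x1 x2 [y1 [y1' [s1 s1' /rat_ballE py1 /rat_ballE qy1']]].
move=> [y2 [y2' [s2 s2' /rat_ballE py2 /rat_ballE qy2']]].
pose D (j : 'I_n) := x1 0 j - x2 0 j.
have close (a b : V) : (forall j, `|ratr (q 0 j) - a 0 j| < r) ->
    (forall j, `|ratr (p 0 j) - b 0 j| < r) ->
    `|\sum_j (a 0 j - b 0 j - w j) * D j| <= (2 * r) * \sum_j `|D j|.
  move=> qa pb; apply: sum_absM_le => j.
  have -> : a 0 j - b 0 j - w j =
    (ratr (p 0 j) - b 0 j) - (ratr (q 0 j) - a 0 j) by rewrite /w; ring.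
  apply: le_trans (ler_normB _ _) _.
  by move: (ltW (qa j)) (ltW (pb j)); lra.
have splitw (a b : V) : \sum_j (a 0 j - b 0 j) * D j =
    \sum_j (a 0 j - b 0 j - w j) * D j + \sum_j w j * D j.
  by rewrite -big_split/=; apply: eq_bigr => j _; ring.
(* Monotonicity is applied to the value near [q] over one point and the value near [p] over the
   other; exchanging the two points gives the opposite bound [h2]. *)
have h1 : - ((2 * r) * \sum_j `|D j|) <= \sum_j w j * D j.
  have := supp_monotone S0 s1' s2.
  have := close _ _ qy1' py2; rewrite ler_norml => /andP[_].
  have -> : mono ((x1 : X), (y1' : X)) ((x2 : X), (y2 : X)) =
      \sum_j (y1' 0 j - y2 0 j) * D j by apply: eq_bigr => j _; rewrite mulrC.
  by rewrite splitw; lra.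
have h2 : \sum_j w j * D j <= (2 * r) * \sum_j `|D j|.
  have := supp_monotone S0 s2' s1.
  have := close _ _ qy2' py1; rewrite ler_norml => /andP[+ _].
  have -> : mono ((x2 : X), (y2' : X)) ((x1 : X), (y1 : X)) =
      - \sum_j (y2' 0 j - y1 0 j) * D j.
    by rewrite -sumrN; apply: eq_bigr => j _; rewrite /D /vec /=; ring.
  by rewrite splitw; lra.
have h : `|\sum_j w j * D j| <= (2 * r) * \sum_j `|D j| by rewrite ler_norml h1.
(* The term in [D i] is isolated: its coefficient [|w i|] is at least [3 * r] and absorbs the
   [2 * r] coming from [h], leaving [r]. *)
rewrite mulrAC ler_pdivlMr// -/(D i).
have : `|w i| * `|D i| <= `|\sum_j w j * D j| + \sum_(j < n | j != i) `|w j| * `|D j|.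
  rewrite (bigD1 i)//= -normrM -[X in `|X| <= _](addrK (\sum_(j < n | j != i) w j * D j)).
  apply: le_trans (ler_normB _ _) _; rewrite lerD2l.
  by apply: le_trans (ler_norm_sum _ _ _) _; apply: ler_sum => j _; rewrite normrM.
have : \sum_(j < n | j != i) `|w j| * `|D j| <=
    (\sum_j `|w j|) * \sum_(j < n | j != i) `|D j|.
  rewrite mulr_sumr; apply: ler_sum => j _; rewrite ler_wpM2r//.
  by rewrite (bigD1 j)//= lerDl sumr_ge0.
move: h; rewrite [\sum_j `|D j|](bigD1 i)//=.
have : 3 * r * `|D i| <= `|w i| * `|D i| by rewrite ler_wpM2r.
by rewrite /M mulrDl [_ * r]mulrC; lra.
Qed.

(** Two distinct values over a point differ in some coordinate and lie in small rational cubes, so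
    countably many sets of the kind in [multi_cone] cover [multi]. *)
Lemma multi_negligible (mu : P) :
  (g \x g)%E [set u | mono u.1 u.2 < 0] = 0%E ->
  no_small_charge mu -> mu.-negligible (multi : set X).
Proof.
move=> S0 nsc.
pose A (c : 'I_n * 'rV[rat]_n * 'rV[rat]_n * nat) : set V :=
  if 3 * c.2.+1%:R^-1 <= `|ratr (c.1.2 0 c.1.1.1) - ratr (c.1.1.2 0 c.1.1.1) : R|
  then [set x : V | exists y y' : V,
    [/\ supp ((x : X), (y : X)), supp ((x : X), (y' : X)),
        rat_ball c.1.1.2 c.2 y & rat_ball c.1.2 c.2 y']]
  else set0.
apply: (@negligibleS _ _ _ _ (\bigcup_c (A c : set X))); last first.
  apply: negligible_bigcup_countable => -[[[i p] q] k]; rewrite /A /=.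
  case: ifPn => [H|_]; last exact: negligible_set0.
  have [L L0 cL] := multi_cone S0 H.
  exact: (cone_negligible nsc L0 cL).
move=> x [y [y' [sy sy' yy']]].
have [i yi] : exists i, y 0 i != y' 0 i.
  apply/existsP; apply: contra_notT yy'; rewrite negb_exists => /forallP H.
  by apply/rowP => i; have := H i; rewrite negbK => /eqP.
(* The radius is at most a fifth of the gap between the values; the centres lose at most two radii
   of this gap, so three remain. *)
have e0 : 0 < (2 * `|y' 0 i - y 0 i|) / 5.
  by rewrite divr_gt0// mulr_gt0// normr_gt0 subr_eq0 eq_sym.
have [k ke] := small_nat e0.
have [p py] := rat_ball_dense y k; have [q qy] := rat_ball_dense y' k.
exists (i, p, q, k) => //; rewrite /A /= ifT; first by exists y, y'.
move: ke; set r := k.+1%:R^-1.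
have /rat_ballE/(_ i) := py; have /rat_ballE/(_ i) := qy; rewrite -/r => a b c.
have : y' 0 i - y 0 i = (ratr (q 0 i) - ratr (p 0 i)) - (ratr (q 0 i) - y' 0 i)
   + (ratr (p 0 i) - y 0 i) by ring.
move=> /(congr1 Num.norm) H.
have := ler_normD ((ratr (q 0 i) - ratr (p 0 i)) - (ratr (q 0 i) - y' 0 i)) (ratr (p 0 i) - y 0 i).
have := ler_normB (ratr (q 0 i) - ratr (p 0 i)) (ratr (q 0 i) - y' 0 i).
rewrite -H; lra.
Qed.

End support.

(** * From an optimal plan to a measurable map *)

Section transport_map.
Context {R : realType} {n : nat}.
Notation V := 'rV[R]_n.
Notation X := (Rd R n).
Notation P := (prob R n).

(** Off the null set [K] a slice of the support has at most one point, and the plan charges neither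
    the points above [K] nor the complement of the support. *)
Lemma opt_coupling_map (mu nu : P) (g : prob2 R n) : no_small_charge mu ->
  opt_coupling mu nu g -> (W2sq mu nu < +oo)%E ->
  exists2 t : X -> X, measurable_fun setT t & {ae g, forall z, z.2 = t z.1}.
Proof.
move=> nsc og Woo.
have S0 := opt_coupling_monotone og Woo.
have [K [mK K0 multiK]] := multi_negligible S0 nsc.
pose S x : set V := [set y | supp g ((x : X), (y : X))].
(* The default value is [x] itself, so [t] is the identity on [K] and wherever the slice is
   empty. *)
pose t (x : X) : X := if x \in K then x else xget (x : V) (S x).
have tP x y : ~ K x -> S x y -> t x = y.
  move=> nK Sy; rewrite /t memNset//.
  apply: contrapT => ne; apply: nK; apply: multiK; exists (xget (x : V) (S x)), y.
  by split => //; exact: (xgetI x Sy).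
exists t; last first.
  have [gc _] := og.
  apply: (@negligibleS _ _ _ _ ((fst @^-1` K) `|` ~` supp g)); last first.
    apply: negligibleU; last exact: supp_negligible.
    exists (fst @^-1` K); split => //; last exact: etrans (esym (coupling_fst gc mK)) K0.
    by rewrite -[X in measurable X]setTI; exact: measurable_fst.
  move=> z /= zt; apply: contrapT => /not_orP[nK /contrapT sz]; apply: zt.
  by apply/esym/tP => //; case: (z) sz.
(* Points with a support value in a given compact box. Varying the lower corner [c] expresses both
   the domain [D] of nonempty slices and the superlevel sets of [t]. *)
pose slice (c : 'I_n -> R) (m : nat) : set X := [set x | exists y : V,
  (forall j, c j <= y 0 j <= m%:R) /\ supp g (x, (y : X))].
have mslice c m : measurable (slice c m).
  apply: closed_rd_measurable.
  apply: (@supp_slice_closed _ _ g [set y : V | forall j, c j <= y 0 j <= m%:R]).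
  rewrite [X in compact X](_ : _ =
    [set v : V | forall j, `[c j, m%:R]%classic (v ord0 j)]); last first.
    by apply/seteqP; split => v /= H j; have := H j; rewrite in_itv.
  apply: (@rV_compact R n (fun j => `[c j, m%:R]%classic)) => j.
  exact: segment_compact.
pose D : set X := \bigcup_m slice (fun=> - m%:R) m.
have mD : measurable D by exact: bigcupT_measurable.
have bounded (y : V) : exists m : nat, forall j, - m%:R <= y 0 j <= m%:R.
  exists (Num.truncn (\sum_j `|y 0 j|)).+1 => j.
  have s0 : 0 <= \sum_j `|y 0 j| by rewrite sumr_ge0.
  have /andP[_ /ltW h] := truncn_itv s0.
  by rewrite -ler_norml; apply: le_trans h; rewrite (bigD1 j)//= lerDl sumr_ge0.
have SD x y : S x y -> D x.
  move=> Sy; have [m ym] := bounded y; by exists m => //; exists y.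
apply: measurable_to_rd => i.
apply: (measurability (@RGenCInfty.G R)); first exact: RGenCInfty.measurableE.
move=> _ [_ [c ->] <-]; rewrite setTI.
(* On [K] or off [D] the map is the identity; elsewhere the only support value must have coordinate
   [i] at least [c], so that side of the boxes is raised to [c]. *)
have -> : (fun x => vec (t x) 0 i) @^-1` `[c, +oo[%classic =
  ((K `|` ~` D) `&` ((fun x : X => vec x 0 i) @^-1` `[c, +oo[%classic)) `|`
  ((D `\` K) `&` \bigcup_m slice (fun j => if j == i then Num.max c (- m%:R) else - m%:R) m).
  apply/seteqP; split => x /=.
    move=> ctx; have [Kx|nK] := pselect (K x).
      by left; split; [left|move: ctx; rewrite /t mem_set].
    have [Dx|nD] := pselect (D x); last first.
      left; split; [by right|].
      move: ctx; rewrite /t memNset// xgetPN// => y Sy; exact/nD/(SD _ y).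
    right; split => //.
    have [m0 _ [y0 [_ Sy0]]] := Dx.
    have [m ym] := bounded y0; exists m => //; exists y0; split => // j.
    move: ctx; rewrite (tP x y0)// in_itv/= andbT /vec => cy.
    case: eqP => [->|_]; last exact: ym.
    by rewrite ge_max cy/= ym.
  move=> [[[Kx|nD]]|[[Dx nK]]].
  - by rewrite /t mem_set.
  - rewrite /t; case: ifPn => // _; rewrite xgetPN// => y Sy; exact/nD/(SD _ y).
  - move=> [m _ [y [yb Sy]]]; rewrite (tP x y)//.
    have := yb i; rewrite eqxx in_itv/= andbT => /andP[+ _].
    by rewrite ge_max => /andP[].
apply: measurableU; apply: measurableI.
- by apply: measurableU => //; exact: measurableC.
- by rewrite -[X in measurable X]setTI; apply: measurable_coord.
- exact: measurableD.
- by apply: bigcupT_measurable => m; exact: mslice.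
Qed.

End transport_map.

(** * Uniqueness of optimal maps *)

Section mixture.
Context d (T : measurableType d) (R : realType) (P Q : probability T R).
Local Open Scope ereal_scope.

Let half : {nonneg R} := (2^-1%:nng)%R.

Definition mixture : set T -> \bar R := measure_add (mscale half P) (mscale half Q).

HB.instance Definition _ := Measure.on mixture.

Let mixture_setT : mixture setT = 1.
Proof.
rewrite /mixture measure_addE.
rewrite [X in X + _](_ : _ = (2^-1)%:E * P setT)// [X in _ + X](_ : _ = (2^-1)%:E * Q setT)//.
rewrite (probability_setT P) (probability_setT Q) !mule1 -EFinD.
by congr EFin; lra.
Qed.

HB.instance Definition _ := Measure_isProbability.Build _ _ _ mixture mixture_setT.

Lemma mixtureE A : mixture A = (2^-1)%:E * P A + (2^-1)%:E * Q A.
Proof. by rewrite /mixture measure_addE. Qed.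

Lemma ge0_integral_mixture (f : T -> \bar R) : measurable_fun setT f ->
  (forall x, 0 <= f x) ->
  \int[mixture]_x f x = (2^-1)%:E * \int[P]_x f x + (2^-1)%:E * \int[Q]_x f x.
Proof.
by move=> mf f0; rewrite /mixture ge0_integral_measure_add// !ge0_integral_mscale.
Qed.

Lemma ae_mixture (A : T -> Prop) : {ae mixture, forall x, A x} ->
  {ae P, forall x, A x} /\ {ae Q, forall x, A x}.
Proof.
move=> [N [mN N0 AN]]; move: N0; rewrite mixtureE => /eqP.
rewrite padde_eq0 ?mule_ge0// !mule_eq0 !eqe invr_eq0 pnatr_eq0 /= => /andP[P0 Q0].
by split; exists N; split => //; apply/eqP.
Qed.
End mixture.

Lemma half_double (R : realType) (x : \bar R) :
  ((2^-1)%:E * x + (2^-1)%:E * x = x)%E.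
Proof.
case: x => [r| |]; last 2 first.
- by rewrite mulry gtr0_sg// mul1e.
- by rewrite mulrNy gtr0_sg// mul1e.
by rewrite -EFinM -EFinD; congr EFin; lra.
Qed.

Section ot_maps.
Context {R : realType} {n : nat}.
Notation X := (Rd R n).
Notation P := (prob R n).
Local Open Scope ereal_scope.
Implicit Types mu nu : P.

Lemma ot_map_coupling mu nu t : ot_map mu nu t -> exists g : prob2 R n,
  is_pushforward mu (fun x => (x, t x)) g /\ opt_coupling mu nu g.
Proof.
move=> [mt [pt tW]].
have m2 : measurable_fun setT (fun x : X => (x, t x)) by exact: measurable_fun_pair.
have [g gP] := pushforward_exists mu m2.
exists g; split => //; split.
  apply: couplingP => A mA; rewrite gP//.
    by rewrite -[X in measurable X]setTI; exact: measurable_fst.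
  - exact: pt.
  - by rewrite -[X in measurable X]setTI; exact: measurable_snd.
rewrite -tW /cost (ge0_integral_is_pushforward m2 gP)//.
  exact: measurable_sqdistE.
by move=> z; rewrite lee_fin sqdist_ge0.
Qed.

Lemma coupling_map_ot_map mu nu (g : prob2 R n) (t : X -> X) :
  opt_coupling mu nu g -> measurable_fun setT t ->
  {ae g, forall z, z.2 = t z.1} -> ot_map mu nu t.
Proof.
move=> [gc gW] mt gt; split=> //; split.
  move=> A mA.
  have mtf : measurable_fun setT (t \o fst : X * X -> X) by exact: measurableT_comp.
  rewrite (is_pushforward_ae _ mtf gt (coupling_snd gc) mA)//.
  rewrite (coupling_fst gc)// -[X in measurable X]setTI; exact: mt.
rewrite -gW (ge0_integral_is_pushforward _ (coupling_fst gc))//.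
- apply: ae_eq_integral => //.
  + by apply: measurable_sqdistE => //; exact: measurableT_comp.
  + exact: measurable_sqdistE.
  + by apply: filterS gt => z zt _; rewrite -zt.
- exact: measurable_sqdistE.
- by move=> x; rewrite lee_fin sqdist_ge0.
Qed.

(* A convex combination of two optimal plans is optimal, hence again carried
   by a graph. *)
Lemma ot_map_unique mu nu t t' : no_small_charge mu -> W2sq mu nu < +oo ->
  ot_map mu nu t -> ot_map mu nu t' -> {ae mu, forall x, t x = t' x}.
Proof.
move=> nsc Woo ot ot'.
have [g [gP [gc gW]]] := ot_map_coupling ot.
have [g' [gP' [gc' gW']]] := ot_map_coupling ot'.
pose h : prob2 R n := mixture g g'.
have oh : opt_coupling mu nu h.
  split.
    move=> A mA; have [a b] := gc A mA; have [a' b'] := gc' A mA.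
    have hE B : h B = (2^-1)%:E * g B + (2^-1)%:E * g' B by exact: mixtureE.
    by rewrite !hE a b a' b' !half_double.
  rewrite /cost ge0_integral_mixture.
  - by rewrite -!/(cost _) gW gW' half_double.
  - exact: measurable_sqdistE.
  - by move=> z; rewrite lee_fin sqdist_ge0.
have [s ms /ae_mixture[sg sg']] := opt_coupling_map nsc oh Woo.
have [mt _] := ot; have [mt' _] := ot'.
have := ae_pushforward (measurable_fun_pair (@measurable_id _ _ _) mt') gP' sg'.
have := ae_pushforward (measurable_fun_pair (@measurable_id _ _ _) mt) gP sg.
by apply: filterS2 => x /= -> ->.
Qed.

Lemma ot_map_id mu : ot_map mu mu id.
Proof.
split=> //; split=> //; rewrite W2sqxx.
by under eq_integral do rewrite sqdistxx; rewrite integral0.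
Qed.

End ot_maps.

(** * Plans and maps over a fixed base *)

Lemma integral_sqdist_triangle (R : realType) (n : nat) d0 (T : measurableType d0)
    (Q : probability T R) (s t : R) (f h g : T -> Rd R n) :
  0 < s -> 0 < t -> s + t = 1 ->
  measurable_fun setT f -> measurable_fun setT h -> measurable_fun setT g ->
  (\int[Q]_x (sqdist (f x) (g x))%:E <=
   (s^-1)%:E * \int[Q]_x (sqdist (f x) (h x))%:E +
   (t^-1)%:E * \int[Q]_x (sqdist (h x) (g x))%:E)%E.
Proof.
move=> s0 t0 st mf mh mg.
have m1 := measurable_sqdistE mf mh; have m2 := measurable_sqdistE mh mg.
rewrite -!ge0_integralZl_EFin//; do ?[by rewrite invr_ge0 ltW
  | by move=> x _; rewrite lee_fin sqdist_ge0].
rewrite -ge0_integralD//; last 4 first.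
- by move=> x _; rewrite -EFinM lee_fin mulr_ge0 ?sqdist_ge0// invr_ge0 ltW.
- exact: measurable_funeM.
- by move=> x _; rewrite -EFinM lee_fin mulr_ge0 ?sqdist_ge0// invr_ge0 ltW.
- exact: measurable_funeM.
apply: ge0_le_integral => //.
- by move=> x _; rewrite lee_fin sqdist_ge0.
- exact: measurable_sqdistE.
- by apply: emeasurable_funD; exact: measurable_funeM.
- by move=> x _; rewrite -!EFinM -EFinD lee_fin; exact: sqdist_triangle.
Qed.

Lemma half_gt0 (R : realType) : 0 < 2^-1 :> R.
Proof. by rewrite invr_gt0. Qed.

Lemma half_half (R : realType) : 2^-1 + 2^-1 = 1 :> R.
Proof. lra. Qed.

Section plans.
Context {R : realType} {n : nat}.
Notation X := (Rd R n).
Notation P := (prob R n).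
Local Open Scope ereal_scope.
Implicit Types om a b : P.

Lemma measurable_z11 : measurable_fun setT (fun z : X * X * X => z.1.1).
Proof. by apply: (measurableT_comp measurable_fst); exact: measurable_fst. Qed.

Lemma measurable_z12 : measurable_fun setT (fun z : X * X * X => z.1.2).
Proof. by apply: (measurableT_comp measurable_snd); exact: measurable_fst. Qed.

Lemma measurable_z2 : measurable_fun setT (fun z : X * X * X => z.2).
Proof. exact: measurable_snd. Qed.

Lemma measurable_z11_12 : measurable_fun setT (fun z : X * X * X => (z.1.1, z.1.2)).
Proof. by apply: measurable_fun_pair; [exact: measurable_z11|exact: measurable_z12]. Qed.

Lemma measurable_z11_2 : measurable_fun setT (fun z : X * X * X => (z.1.1, z.2)).
Proof. by apply: measurable_fun_pair; [exact: measurable_z11|exact: measurable_z2]. Qed.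

Lemma plan_marginals om a b (w : prob3 R n) : transport_plan om a b w ->
  [/\ is_pushforward w (fun z => z.1.1) om, is_pushforward w (fun z => z.1.2) a,
      is_pushforward w (fun z => z.2) b,
      \int[w]_z (sqdist z.1.1 z.1.2)%:E = W2sq om a &
      \int[w]_z (sqdist z.1.1 z.2)%:E = W2sq om b].
Proof.
move=> [[g [gw [gc gW]]] [g' [gw' [gc' gW']]]]; split.
- exact: (is_pushforward_comp measurable_fst gw (coupling_fst gc)).
- exact: (is_pushforward_comp measurable_snd gw (coupling_snd gc)).
- exact: (is_pushforward_comp measurable_snd gw' (coupling_snd gc')).
- rewrite -gW /cost (ge0_integral_is_pushforward measurable_z11_12 gw)//.
    exact: measurable_sqdistE.
  by move=> z; rewrite lee_fin sqdist_ge0.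
- rewrite -gW' /cost (ge0_integral_is_pushforward measurable_z11_2 gw')//.
    exact: measurable_sqdistE.
  by move=> z; rewrite lee_fin sqdist_ge0.
Qed.

Lemma plan_triangle om a b (w : prob3 R n) (s t : R) : transport_plan om a b w ->
  (0 < s)%R -> (0 < t)%R -> (s + t = 1)%R ->
  W2sq a b <= (s^-1)%:E * W2sq om a + (t^-1)%:E * W2sq om b.
Proof.
move=> /plan_marginals[_ wa wb <- <-] s0 t0 st.
apply: le_trans (W2sq_le measurable_z12 measurable_z2 wa wb) _.
apply: le_trans (integral_sqdist_triangle w s0 t0 st
  measurable_z12 measurable_z11 measurable_z2) _.
by under [X in _ * X + _]eq_integral do rewrite sqdist_sym.
Qed.

(** Both pair marginals of [w] from the base are carried by graphs, so [w] is the law of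
    [(x, t0 x, t1 x)] under [om]. *)
Lemma plan_maps om a b (w : prob3 R n) : no_small_charge om ->
  W2sq om a < +oo -> W2sq om b < +oo -> transport_plan om a b w ->
  exists t0 t1, [/\ ot_map om a t0, ot_map om b t1,
    {ae w, forall z, z.1.2 = t0 z.1.1} & {ae w, forall z, z.2 = t1 z.1.1}].
Proof.
move=> nsc Wa Wb [[g [gw og]] [g' [gw' og']]].
have [t0 m0 g0] := opt_coupling_map nsc og Wa.
have [t1 m1 g1] := opt_coupling_map nsc og' Wb.
exists t0, t1; split.
- exact: coupling_map_ot_map og m0 g0.
- exact: coupling_map_ot_map og' m1 g1.
- exact: (ae_pushforward measurable_z11_12 gw g0).
- exact: (ae_pushforward measurable_z11_2 gw' g1).
Qed.

End plans.

Section convex_setting.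
Context {R : realType} {n : nat}.
Notation X := (Rd R n).
Notation P := (prob R n).
Local Open Scope ereal_scope.
Variables (omega0 : P) (E : P -> \bar R) (lam : R).
Hypothesis hconv : convex_gen_geod omega0 E lam.
Implicit Types a b c : P.

Lemma P2_refl : P2 omega0 omega0.
Proof. by rewrite /P2 W2sqxx. Qed.

(** The plan that [hconv] supplies with base [b] glues an optimal coupling of [b] and [a] to one of
    [b] and [c]. *)
Lemma W2sq_triangle a b c (s t : R) : P2 omega0 a -> P2 omega0 b -> P2 omega0 c ->
  (0 < s)%R -> (0 < t)%R -> (s + t = 1)%R ->
  W2sq a c <= (s^-1)%:E * W2sq a b + (t^-1)%:E * W2sq b c.
Proof.
move=> Pa Pb Pc s0 t0 st; have [w [wp _]] := hconv Pa Pc Pb.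
by rewrite (W2sq_sym a b); exact: plan_triangle wp _ _ _.
Qed.

Lemma W2sq_lty a b : P2 omega0 a -> P2 omega0 b -> W2sq a b < +oo.
Proof.
move=> Pa Pb; have h0 := half_gt0 R.
apply: le_lt_trans (W2sq_triangle Pa P2_refl Pb h0 h0 (half_half R)) _.
by rewrite (W2sq_sym omega0) lte_add_pinfty// lte_mul_pinfty// lee_fin !invr_ge0.
Qed.

Section base.
Variable mu : P.
Hypothesis (hmu : P2 omega0 mu) (nsc : no_small_charge mu).

(** An optimal plan is read off from [hconv] with base [mu] and both ends equal to [a]. *)
Lemma exists_ot_map a : P2 omega0 a -> exists t, ot_map mu a t.
Proof.
move=> Pa; have [w [wp _]] := hconv Pa Pa hmu.
have Woo := W2sq_lty hmu Pa.
by have [t [_ [ot _ _ _]]] := plan_maps nsc Woo Woo wp; exists t.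
Qed.

Lemma P2_pushforward a (f : X -> X) : measurable_fun setT f ->
  is_pushforward mu f a -> \int[mu]_x (sqdist x (f x))%:E < +oo -> P2 omega0 a.
Proof.
move=> mf fa foo; have [t [mt [pt tW]]] := exists_ot_map P2_refl.
have h0 := half_gt0 R.
apply: le_lt_trans (W2sq_le mf mt fa pt) _.
apply: le_lt_trans (integral_sqdist_triangle mu h0 h0 (half_half R) mf
  (@measurable_id _ _ _) mt) _ => /=.
under [X in _ * X + _]eq_integral do rewrite sqdist_sym.
by rewrite lte_add_pinfty// lte_mul_pinfty// ?lee_fin ?invr_ge0// tW W2sq_lty//; exact: P2_refl.
Qed.

(** By uniqueness of optimal maps, the plan given by [hconv] is the law of [(x, t0 x, t1 x)] for the
    prescribed maps, so its estimate transfers to [L^2(mu)]. *)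
Lemma convex_along_maps a b c t0 t1 (al : R) : P2 omega0 a -> P2 omega0 b ->
  ot_map mu a t0 -> ot_map mu b t1 -> (0 <= al)%R -> (al <= 1)%R ->
  is_pushforward mu (fun x => of_vec ((1 - al) *: vec (t0 x) + al *: vec (t1 x))) c ->
  E c <= (1 - al)%:E * E a + al%:E * E b
         - (al * (1 - al) * lam / 2)%:E * \int[mu]_x (sqdist (t0 x) (t1 x))%:E.
Proof.
move=> Pa Pb ot0 ot1 al0 al1 pc.
have [w [wp wE]] := hconv Pa Pb hmu.
have Wa := W2sq_lty hmu Pa; have Wb := W2sq_lty hmu Pb.
have [s0 [s1 [os0 os1 ws0 ws1]]] := plan_maps nsc Wa Wb wp.
have [wm _ _ _ _] := plan_marginals wp.
have [m0 _] := ot0; have [m1 _] := ot1.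
have wt0 : {ae w, forall z, z.1.2 = t0 z.1.1}.
  have := ae_pushforward measurable_z11 wm (ot_map_unique nsc Wa os0 ot0).
  by apply: filterS2 ws0 => z -> ->.
have wt1 : {ae w, forall z, z.2 = t1 z.1.1}.
  have := ae_pushforward measurable_z11 wm (ot_map_unique nsc Wb os1 ot1).
  by apply: filterS2 ws1 => z -> ->.
have mcomb : measurable_fun setT
    (fun x : X => of_vec ((1 - al) *: vec (t0 x) + al *: vec (t1 x))).
  exact: measurable_comb.
have pw : is_pushforward w (interp al) c.
  apply: is_pushforward_ae (is_pushforward_comp mcomb wm pc).
  - exact: (measurableT_comp mcomb measurable_z11).
  - exact: measurable_comb measurable_z12 measurable_z2.
  - by apply: filterS2 wt0 wt1 => z; rewrite /interp /= => -> ->.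
have -> : \int[mu]_x (sqdist (t0 x) (t1 x))%:E = plan_W2sq w.
  rewrite (ge0_integral_is_pushforward measurable_z11 wm); last 2 first.
  - exact: measurable_sqdistE.
  - by move=> x; rewrite lee_fin sqdist_ge0.
  apply: ae_eq_integral => //.
  - by apply: measurable_sqdistE;
      [exact: (measurableT_comp m0 measurable_z11)|
       exact: (measurableT_comp m1 measurable_z11)].
  - exact: measurable_sqdistE measurable_z12 measurable_z2.
  - by apply: filterS2 wt0 wt1 => z -> -> _.
exact: wE.
Qed.

End base.
End convex_setting.

(** * Limits in [L^2] *)

Section liminf.
Context {R : realType}.
Local Open Scope ereal_scope.

Lemma limn_einf_sup_einfs (u : (\bar R)^nat) :
  limn_einf u = ereal_sup (range (einfs u)).
Proof. by rewrite limn_einf_lim; apply/cvg_lim => //; exact: cvg_einfs_sup. Qed.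

Lemma lt_limn_einf (u : (\bar R)^nat) (r : \bar R) : r < limn_einf u ->
  exists N, forall k, (N <= k)%N -> r < u k.
Proof.
rewrite limn_einf_sup_einfs => /ereal_sup_gt[_ [N _ <-]] rN; exists N => k Nk.
by apply: lt_le_trans rN _; apply: ereal_inf_lbound; exists k.
Qed.

Lemma limn_einf_le (u : (\bar R)^nat) (r : \bar R) N :
  (forall k, (N <= k)%N -> u k <= r) -> limn_einf u <= r.
Proof.
move=> ur; rewrite leNgt; apply/negP => /lt_limn_einf[M Mu].
have := ur (maxn N M) (leq_maxl _ _); rewrite leNgt => /negP; apply.
exact/Mu/leq_maxr.
Qed.
End liminf.

Section L2_limit.
Context {R : realType} {n : nat}.
Notation X := (Rd R n).
Notation P := (prob R n).
Variable mu : P.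

Definition cvg_coord (f : nat -> X -> X) (F : X -> X) (x : X) : Prop :=
  forall i, vec (f k x) 0 i @[k --> \oo] --> (vec (F x) 0 i : R).

Lemma cvg_of_summable (u : R^nat) (M : R) :
  (forall N, \sum_(0 <= k < N) `|u k.+1 - u k| <= M) -> cvgn u.
Proof.
move=> uM.
have : cvgn (series (telescope u)).
  apply: normed_cvg; apply: nondecreasing_is_cvgn.
    apply/nondecreasing_seqP => N.
    suff : \sum_(0 <= k < N) `|u k.+1 - u k| <= \sum_(0 <= k < N.+1) `|u k.+1 - u k| by [].
    by rewrite [leRHS]big_nat_recr//= lerDl.
  by exists M => _ [N _ <-]; exact: uM.
move=> cs; have -> : u = (fun k => u 0%N + series (telescope u) k).
  by apply/funext => k; exact: eq_sum_telescope.
by apply: is_cvgD => //; exact: is_cvg_cst.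
Qed.

(* Turns square summability with geometric weights into summability. *)
Lemma weighted_diff_le (d : R) k : `|d| <= 2^-1 ^+ k + 2 ^+ k * d ^+ 2.
Proof.
have p0 : 0 < 2 ^+ k :> R by rewrite exprn_gt0.
rewrite exprVn -[d ^+ 2]real_normK ?num_real//; move: `|d| (normr_ge0 d) => y y0.
have : 0 <= (2 ^+ k)^-1 * (2 ^+ k * y - 2^-1) ^+ 2.
  by rewrite mulr_ge0 ?sqr_ge0// invr_ge0 ltW.
have -> : (2 ^+ k)^-1 * (2 ^+ k * y - 2^-1) ^+ 2 =
   2 ^+ k * y ^+ 2 - y + (2 ^+ k)^-1 / 4 by field; exact: lt0r_neq0.
have : 0 < (2 ^+ k)^-1 :> R by rewrite invr_gt0.
lra.
Qed.

Lemma coord_sq_le_sqdist (x y : X) i : (vec x 0 i - vec y 0 i) ^+ 2 <= sqdist x y.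
Proof. by rewrite /sqdist (bigD1 i)//= lerDl sumr_ge0// => j _; exact: sqr_ge0. Qed.

Lemma nneseries_half_lty (c : R) : 0 <= c ->
  (\big[+%E/0]_(0 <= k <oo) (c * 2^-1 ^+ k)%:E < +oo)%E.
Proof.
move=> c0; have t0 k : (0 <= (c * 2^-1 ^+ k)%:E)%E.
  by rewrite lee_fin mulr_ge0// exprn_ge0// invr_ge0.
suff : (\big[+%E/0]_(0 <= k <oo) (c * 2^-1 ^+ k)%:E <= (c / (1 - 2^-1))%:E)%E.
  by move=> /le_lt_trans; apply; rewrite ltry.
apply: lime_le; first by apply: is_cvg_nneseries.
apply: nearW => N; rewrite sumEFin lee_fin.
apply: (@geometric_le_lim _ N c 2^-1) => //.
by rewrite ger0_norm// invf_lt1// ltr1n.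
Qed.

(** The squared increments weighted by [2^k] have integrals at most [c / 2^k], so their sum is
    finite almost everywhere; there [weighted_diff_le] makes the increments of each coordinate
    summable. *)
Lemma L2_limit_exists (f : nat -> X -> X) (c : R) : 0 <= c ->
  (forall k, measurable_fun setT (f k)) ->
  (forall k, \int[mu]_x (sqdist (f k.+1 x) (f k x))%:E <= (c * 4^-1 ^+ k)%:E)%E ->
  exists2 F, measurable_fun setT F & {ae mu, forall x, cvg_coord f F x}.
Proof.
move=> c0 mf fc.
(* An upper limit by coordinates is measurable everywhere; [fine] sends the infinite values to 0. *)
pose F (x : X) : X :=
  of_vec (\row_i fine (limn_esup (fun k => (vec (f k x) 0 i)%:E))).
exists F.
  apply: measurable_to_rd => i; rewrite /F /of_vec.
  under eq_fun do rewrite /vec mxE.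
  apply: measurableT_comp => //; apply: measurable_fun_limn_esup => k.
  by apply/measurable_EFinP; exact: (measurableT_comp (measurable_coord i) (mf k)).
pose s k x := (2 ^+ k * sqdist (f k.+1 x) (f k x))%:E.
have s0 k x : (0 <= s k x)%E by rewrite lee_fin mulr_ge0 ?sqdist_ge0// exprn_ge0.
have ms k : measurable_fun setT (s k).
  by apply/measurable_EFinP; apply: measurable_funM => //; exact: measurable_sqdist.
pose G x := (\big[+%E/0]_(0 <= k <oo) s k x)%E.
have mG : measurable_fun setT G by apply: ge0_emeasurable_sum.
have G0 x : (0 <= G x)%E by apply: nneseries_ge0 => k _ _; exact: s0.
have iG : mu.-integrable setT G.
  apply/integrableP; split => //.
  under eq_integral do rewrite gee0_abs//.
  rewrite integral_nneseries//.
  apply: le_lt_trans (nneseries_half_lty c0); apply: lee_nneseries => [k _ _|k _].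
    exact: integral_ge0.
  under eq_integral do rewrite /s EFinM.
  rewrite ge0_integralZl_EFin//; last 2 first.
  - by move=> x _; rewrite lee_fin sqdist_ge0.
  - exact: measurable_sqdistE.
  apply: le_trans (lee_wpmul2l _ (fc k)) _; first by rewrite lee_fin exprn_ge0.
  rewrite -EFinM lee_fin mulrCA -exprMn.
  by have -> : 2 * 4^-1 = 2^-1 :> R by lra.
have := integrable_ae measurableT iG; apply: filterS => x /(_ I) Gfin i.
have cu : cvgn (fun k => vec (f k x) 0 i : R).
  apply: (@cvg_of_summable _ (1 / (1 - 2^-1) + fine (G x))) => N.
  apply: le_trans (_ : \sum_(0 <= k < N)
    (2^-1 ^+ k + 2 ^+ k * sqdist (f k.+1 x) (f k x)) <= _).
    apply: ler_sum => k _; apply: le_trans (weighted_diff_le _ k) _.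
    by rewrite lerD2l ler_wpM2l ?exprn_ge0// coord_sq_le_sqdist.
  rewrite big_split/=; apply: lerD.
    have := @geometric_le_lim R N 1 2^-1 ler01.
    rewrite /series /geometric/=; under eq_bigr do rewrite mul1r.
    by apply => //; rewrite ger0_norm// invf_lt1// ltr1n.
  rewrite -lee_fin fineK// -sumEFin.
  exact: (@nneseries_lim_ge _ (s^~ x) xpredT 0 N).
have /cvg_ex[l ul] := cu.
suff -> : vec (F x) 0 i = l by [].
rewrite /F /of_vec /vec mxE.
have : (vec (f k x) 0 i)%:E @[k --> \oo] --> l%:E.
  by apply: cvg_EFin => //; exact: nearW.
by move=> /cvg_limn_einf_sup[_ ->].
Qed.

Lemma fatou_sqdist (f : nat -> X -> X) (F g : X -> X) :
  (forall k, measurable_fun setT (f k)) -> measurable_fun setT F ->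
  measurable_fun setT g -> {ae mu, forall x, cvg_coord f F x} ->
  (\int[mu]_x (sqdist (g x) (F x))%:E <=
   limn_einf (fun k => \int[mu]_x (sqdist (g x) (f k x))%:E))%E.
Proof.
move=> mf mF mg fF.
have mk k : measurable_fun setT (fun x => (sqdist (g x) (f k x))%:E).
  exact: measurable_sqdistE.
apply: le_trans (fatou mu measurableT mk _); last first.
  by move=> k x _; rewrite lee_fin sqdist_ge0.
apply: ae_ge0_le_integral => //.
- by move=> x _; rewrite lee_fin sqdist_ge0.
- exact: measurable_sqdistE.
- move=> x _; rewrite limn_einf_sup_einfs; apply: le_trans (ereal_sup_ubound _); last by exists 0%N.
  by apply: le_ereal_inf_tmp => _ [k _ <-]; rewrite lee_fin sqdist_ge0.
- apply: measurableT_comp => //; apply: measurable_fun_limn_esup => k.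
  exact: measurableT_comp.
apply: filterS fF => x cx _.
suff : (sqdist (g x) (f k x))%:E @[k --> \oo] --> (sqdist (g x) (F x))%:E.
  by move=> /cvg_limn_einf_sup[-> _].
apply: cvg_EFin; first exact: nearW.
rewrite /sqdist; apply: cvg_big => [|i _]; first exact: add_continuous.
by rewrite /=; under eq_fun do rewrite expr2; rewrite expr2; apply: cvgM; apply: cvgB;
  [exact: cvg_cst|exact: cx|exact: cvg_cst|exact: cx].
Qed.
End L2_limit.

(** * The minimization problem *)

(** The integral of [sqdist_comb], with the negative term moved to the left so that the identity
    makes sense for infinite integrals. *)
Lemma integral_sqdist_comb (R : realType) (n : nat) (mu : prob R n) (al : R)
    (t0 t1 : Rd R n -> Rd R n) : 0 <= al -> al <= 1 ->
  measurable_fun setT t0 -> measurable_fun setT t1 ->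
  (\int[mu]_x (sqdist x (of_vec ((1 - al) *: vec (t0 x) + al *: vec (t1 x))))%:E +
   (al * (1 - al))%:E * \int[mu]_x (sqdist (t0 x) (t1 x))%:E =
   (1 - al)%:E * \int[mu]_x (sqdist x (t0 x))%:E +
   al%:E * \int[mu]_x (sqdist x (t1 x))%:E)%E.
Proof.
move=> a0 a1 m0 m1; have b0 : 0 <= 1 - al by rewrite subr_ge0.
have mid := @measurable_id _ (Rd R n) setT.
have msq (f g : Rd R n -> Rd R n) c : measurable_fun setT f ->
    measurable_fun setT g -> measurable_fun setT (fun x => c%:E * (sqdist (f x) (g x))%:E)%E.
  by move=> mf mg; apply: measurable_funeM; exact: measurable_sqdistE.
have sq0 (x y : Rd R n) c : 0 <= c -> (0 <= c%:E * (sqdist x y)%:E)%E.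
  by move=> c0; rewrite -EFinM lee_fin mulr_ge0// sqdist_ge0.
have sq1 (x y : Rd R n) : (0 <= (sqdist x y)%:E)%E by rewrite lee_fin sqdist_ge0.
have ab0 : 0 <= al * (1 - al) by rewrite mulr_ge0.
have mc := measurable_comb (1 - al) al m0 m1.
have m01 := measurable_sqdistE m0 m1.
have mx0 := measurable_sqdistE mid m0; have mx1 := measurable_sqdistE mid m1.
have mxc := measurable_sqdistE mid mc.
rewrite -!ge0_integralZl_EFin//; do ?by move=> x _; exact: sq1.
rewrite -!ge0_integralD//; do ?[by move=> x _; exact: sq1|by move=> x _; exact: sq0|
  exact: msq].
by apply: eq_integral => x _; rewrite -!EFinM -!EFinD sqdist_comb; congr EFin; ring.
Qed.

Section prox.
Context {R : realType} {n : nat}.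
Notation X := (Rd R n).
Notation P := (prob R n).
Local Open Scope ereal_scope.
Variables (omega0 : P) (E : P -> \bar R) (lam : R).
Hypothesis hconv : convex_gen_geod omega0 E lam.
Hypothesis E_gt : forall a, P2 omega0 a -> -oo < E a.
Variable mu : P.
Hypothesis (hmu : P2 omega0 mu) (nsc : no_small_charge mu).
Variable tau : R.
Hypothesis (tau0 : (0 < tau)%R) (kappa0 : (0 < tau^-1 + lam)%R).
Implicit Types a b c : P.

(** The convexity modulus of [Phi] along interpolations of optimal maps from [mu]: [tau^-1] comes
    from the squared distance and [lam] from [E]. *)
Let kappa := (tau^-1 + lam)%R.
Let Phi a := ((2 * tau)^-1)%:E * W2sq mu a + E a.

Lemma W2sq_fineE a b : P2 omega0 a -> P2 omega0 b -> W2sq a b = (fine (W2sq a b))%:E.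
Proof.
by move=> Pa Pb; rewrite fineK// ge0_fin_numE ?W2sq_ge0// (W2sq_lty hconv).
Qed.

(* The midpoint map (t + t') / 2 competes in the minimisation. *)
Lemma almost_minimizers_close (I e e' : R) a a' t t' :
  (forall c, P2 omega0 c -> I%:E <= Phi c) ->
  P2 omega0 a -> P2 omega0 a' -> ot_map mu a t -> ot_map mu a' t' ->
  Phi a <= (I + e)%:E -> Phi a' <= (I + e')%:E ->
  \int[mu]_x (sqdist (t x) (t' x))%:E <= (4 * (e + e') / kappa)%:E.
Proof.
move=> IPhi Pa Pa' ot ot' Pe Pe'.
have [mt [_ tW]] := ot; have [mt' [_ tW']] := ot'.
have h0 := half_gt0 R.
have h1 : (2^-1 <= 1 :> R)%R by lra.
have mid := @measurable_id _ X setT.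
pose f x := of_vec ((1 - 2^-1) *: vec (t x) + 2^-1 *: vec (t' x)).
have mf : measurable_fun setT f by exact: measurable_comb.
have [c pc] := pushforward_exists mu mf.
have comb := integral_sqdist_comb mu (ltW h0) h1 mt mt'.
rewrite tW tW' (W2sq_fineE hmu Pa) (W2sq_fineE hmu Pa') -/f in comb.
have D0 : 0 <= \int[mu]_x (sqdist (t x) (t' x))%:E.
  by apply: integral_ge0 => x _; rewrite lee_fin sqdist_ge0.
have M0 : 0 <= \int[mu]_x (sqdist x (f x))%:E.
  by apply: integral_ge0 => x _; rewrite lee_fin sqdist_ge0.
have convE := convex_along_maps hconv hmu nsc Pa Pa' ot ot' (ltW h0) h1 pc.
have Wc := W2sq_le mid mf (fun A mA => erefl) pc.
move: comb D0 M0 Wc convE (IPhi c) (@P2_pushforward _ _ _ _ _ hconv _ hmu nsc _ _ mf pc) => /=.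
(* Infinite integrals are excluded by [comb], whose right-hand side is finite. *)
case: (\int[mu]_x (sqdist x (f x))%:E) => [M| |]//; last first.
  case: (\int[mu]_x (sqdist (t x) (t' x))%:E) => [r| |]//.
  by rewrite gt0_muley// lte_fin; lra.
case: (\int[mu]_x (sqdist (t x) (t' x))%:E) => [D| |]//; last first.
  by rewrite gt0_muley ?lte_fin//; lra.
rewrite -!EFinM -!EFinD => -[comb] D0 M0 Wc convE Ic /(_ (ltry _)) Pc.
have {Ic} := Ic Pc; rewrite /Phi.
move: Wc; rewrite (W2sq_fineE hmu Pc) !lee_fin => Wc.
move: Pe Pe' convE; rewrite /Phi (W2sq_fineE hmu Pa) (W2sq_fineE hmu Pa').
move: (E_gt Pa) (E_gt Pa') (E_gt Pc).
case: (E a) => [ea| |]//; case: (E a') => [ea'| |]//; case: (E c) => [ec| |]// _ _ _.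
rewrite -!EFinM -!EFinD !lee_fin.
set wa := fine _ in comb *; set wa' := fine _ in comb *; set wc := fine _ in Wc *.
have -> : ((2 * tau)^-1 = tau^-1 / 2 :> R)%R by field; exact: lt0r_neq0.
have ti0 : (0 < tau^-1)%R by rewrite invr_gt0.
rewrite ler_pdivlMr// /kappa.
move: (tau^-1)%R ti0 comb Wc => u u0 comb Wc Pe Pe' convE Ic.
have uc : (u / 2 * wc <= u / 2 * M)%R by rewrite ler_wpM2l// divr_ge0// ltW.
have uM : (u * M = u * (wa / 2 + wa' / 2 - D / 4))%R by congr (_ * _)%R; lra.
nra.
Qed.

(** With zero errors, [almost_minimizers_close] makes the two optimal maps equal almost
    everywhere. *)
Lemma minimizer_unique a a' : is_prox omega0 E tau mu a ->
  is_prox omega0 E tau mu a' -> Phi a < +oo -> meq a' a.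
Proof.
move=> [Pa ma] [Pa' ma'] Phioo.
have [t ot] := exists_ot_map hconv hmu nsc Pa.
have [t' ot'] := exists_ot_map hconv hmu nsc Pa'.
have : exists r : R, Phi a = r%:E.
  move: Phioo; rewrite /Phi (W2sq_fineE hmu Pa); move: (E_gt Pa).
  by case: (E a) => [ea| |]// _ _; rewrite -EFinM -EFinD; eexists.
move=> [r ar].
have ar' : Phi a <= (r + 0)%:E by rewrite ar addr0.
have ar'' : Phi a' <= (r + 0)%:E by rewrite addr0 -ar; exact: ma'.
have rPhi c : P2 omega0 c -> r%:E <= Phi c by move=> Pc; rewrite -ar; exact: ma.
have := almost_minimizers_close rPhi Pa Pa' ot ot' ar' ar''.
rewrite addr0 mulr0 mul0r => D0.
have [mt [pt _]] := ot; have [mt' [pt' _]] := ot'.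
have mD := measurable_sqdistE mt mt'.
have : \int[mu]_x `|(sqdist (t x) (t' x))%:E| = 0.
  apply/eqP; rewrite eq_le integral_ge0// andbT; apply: le_trans D0.
  by under eq_integral do rewrite gee0_abs ?lee_fin ?sqdist_ge0//.
move=> /(ae_eq_integral_abs mu measurableT mD) tt'.
have tt : {ae mu, forall x, t x = t' x}.
  by apply: filterS tt' => x /(_ I) [] /sqdist_eq0.
by move=> A mA; rewrite pt'// (is_pushforward_ae mt mt' tt pt mA).
Qed.


(** * Existence of the minimizer *)

Section existence.
Hypothesis (hmuE : E mu < +oo) (hcoer : coercive omega0 E) (hlsc : W2_lsc omega0 E).

(** Coercivity is known only for [u0] and [tau1]. It is applied to the point [b] at fraction [al] of
    the way from [mu] to [c], at squared distance at most [al^2 * W2sq mu c] from [mu]; convexity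
    turns the lower bound on [E b] into one on [E c]. *)
Lemma Phi_bounded_below : exists I : R, forall c, P2 omega0 c -> I%:E <= Phi c.
Proof.
have [tau1 [tau10 [u0 [Pu0 inf_gt]]]] := hcoer.
have [C Cle] : exists C : R, forall c, P2 omega0 c ->
    C%:E <= ((2 * tau1)^-1)%:E * W2sq u0 c + E c.
  move: inf_gt; set J := ereal_inf _ => J_gt.
  have lb c : P2 omega0 c -> J <= ((2 * tau1)^-1)%:E * W2sq u0 c + E c.
    by move=> Pc; apply: ereal_inf_lbound; exists c.
  case: J J_gt lb => [r| |]// _ lb; first by exists r.
  by exists 0%R => c Pc; apply: le_trans (lb c Pc); rewrite leey.
have [s [ms [ps sW]]] := exists_ot_map hconv hmu nsc Pu0.
pose v := ((2 * tau1)^-1)%R; have v0 : (0 < v)%R by rewrite invr_gt0 mulr_gt0.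
have Emu : E mu = (fine (E mu))%:E by rewrite fineK// fin_numElt E_gt.
pose e0 := fine (E mu); pose U := fine (W2sq mu u0).
pose den := (kappa + (4 * v + `|lam|))%R.
have den0 : (0 < den)%R by rewrite ltr_wpDr// addr_ge0// mulr_ge0// ltW.
pose al := (kappa / den)%R.
have al0 : (0 < al)%R by rewrite divr_gt0.
have al1 : (al <= 1)%R.
  by rewrite ler_pdivrMr// mul1r lerDl addr_ge0// mulr_ge0// ltW.
(* This smallness of al makes the coefficient of W2sq mu c nonnegative. *)
have alk : (al * (2 * v + lam / 2) <= kappa / 2)%R.
  have h1 : (al * (4 * v + `|lam|) <= kappa)%R.
    rewrite /al mulrAC ler_pdivrMr//.
    by rewrite ler_wpM2l ?(ltW kappa0)// /den lerDr ltW.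
  have h2 : (al * lam <= al * `|lam|)%R by rewrite ler_wpM2l ?ler_norm// ltW.
  by lra.
exists ((C - 2 * v * U - (1 - al) * e0) / al)%R => c Pc.
rewrite /Phi (W2sq_fineE hmu Pc).
move: (E_gt Pc); case Ec : (E c) => [ec| |]// _; last by rewrite addey// leey.
have [t ot] := exists_ot_map hconv hmu nsc Pc; have [mt [_ tW]] := ot.
have mid := @measurable_id _ X setT.
pose f x := of_vec ((1 - al) *: vec (id x) + al *: vec (t x)).
have mf : measurable_fun setT f by exact: measurable_comb.
have [b pb] := pushforward_exists mu mf.
have := integral_sqdist_comb mu (ltW al0) al1 mid mt.
have := convex_along_maps hconv hmu nsc hmu Pc (ot_map_id mu) ot (ltW al0) al1 pb.
rewrite -/f tW (W2sq_fineE hmu Pc) Emu Ec -/e0; set D := fine _.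
have -> : \int[mu]_x (sqdist x (id x))%:E = 0.
  by under eq_integral do rewrite sqdistxx; rewrite integral0.
have M0 : 0 <= \int[mu]_x (sqdist x (f x))%:E.
  by apply: integral_ge0 => x _; rewrite lee_fin sqdist_ge0.
have Wb : W2sq u0 b <= (2^-1^-1)%:E * (W2sq mu u0) +
    (2^-1^-1)%:E * \int[mu]_x (sqdist x (f x))%:E.
  apply: le_trans (W2sq_le ms mf ps pb) _.
  apply: le_trans (integral_sqdist_triangle mu (half_gt0 R) (half_gt0 R) (half_half R) ms
    mid mf) _.
  by rewrite -sW; under [X in _ * X + _]eq_integral do rewrite sqdist_sym.
move: M0 Wb (@P2_pushforward _ _ _ _ _ hconv _ hmu nsc _ _ mf pb).
case: (\int[mu]_x (sqdist x (f x))%:E) => [M| |]//.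
move=> M0 Wb /(_ (ltry _)) Pb.
have := Cle b Pb; move: Wb.
rewrite (W2sq_fineE hmu Pu0) (W2sq_fineE Pu0 Pb) mule0 add0e -/U.
move: (E_gt Pb); case: (E b) => [eb| |]// _.
rewrite -!EFinM -!EFinD !lee_fin -/v invrK => Wb Cb convE [comb].
have vW : (v * fine (W2sq u0 b) <= v * (2 * U + 2 * M))%R by rewrite ler_wpM2l// ltW.
have MD : (M = al * al * D)%R by lra.
have D0 : (0 <= D)%R by rewrite fine_ge0// W2sq_ge0.
have -> : ((2 * tau)^-1 = tau^-1 / 2 :> R)%R by field; exact: lt0r_neq0.
rewrite ler_pdivrMr//.
have aD : (al * D * (al * (2 * v + lam / 2)) <= al * D * (kappa / 2))%R.
  by rewrite ler_wpM2l// mulr_ge0// ltW.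
rewrite MD in vW; rewrite /kappa in aD; rewrite /=; lra.
Qed.

Lemma minimizer_exists : exists m, is_prox omega0 E tau mu m /\ Phi m < +oo.
Proof.
have [I0 I0P] := Phi_bounded_below.
pose S := [set Phi c | c in [set c | P2 omega0 c]].
have Phimu : Phi mu < +oo by rewrite /Phi W2sqxx mule0 add0e.
have [J JE] : exists J : R, ereal_inf S = J%:E.
  have : I0%:E <= ereal_inf S by apply: le_ereal_inf_tmp => _ [c Pc <-]; exact: I0P.
  have : ereal_inf S < +oo by apply: le_lt_trans Phimu; apply: ereal_inf_lbound; exists mu.
  by case: (ereal_inf S) => // r _ _; exists r.
have JP c : P2 omega0 c -> J%:E <= Phi c.
  by move=> Pc; rewrite -JE; apply: ereal_inf_lbound; exists c.
(* The errors decay at the rate that [L2_limit_exists] requires. *)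
pose ep k : R := (4^-1 ^+ k)%R.
have ep0 k : (0 < ep k)%R by rewrite exprn_gt0// invr_gt0.
have ep_le k l : (k <= l)%N -> (ep l <= ep k)%R.
  by move=> kl; apply: ler_wiXn2l => //; rewrite ?invr_ge0// invf_le1// ler1n.
have /choice[v vP] k : exists c, P2 omega0 c /\ Phi c <= (J + ep k)%:E.
  have : ereal_inf S < (J + ep k)%:E by rewrite JE lte_fin ltrDl.
  by move=> /ereal_inf_lt[_ [c Pc <-]] /ltW ?; exists c.
have Pv k := (vP k).1; have Phiv k := (vP k).2.
have /choice[t ot] k := exists_ot_map hconv hmu nsc (Pv k).
have mt k : measurable_fun setT (t k) by have [] := ot k.
have tW k : \int[mu]_x (sqdist x (t k x))%:E = W2sq mu (v k) by have [_ []] := ot k.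
(* The constant is [4 / kappa] from [almost_minimizers_close], doubled because both errors are at
   most [ep k]. *)
pose C := (8 / kappa)%R; have C0 : (0 < C)%R by rewrite divr_gt0.
have cauchy k l : (k <= l)%N ->
    \int[mu]_x (sqdist (t k x) (t l x))%:E <= (C * ep k)%:E.
  move=> kl; apply: le_trans (almost_minimizers_close JP (Pv k) (Pv l)
    (ot k) (ot l) (Phiv k) (Phiv l)) _.
  rewrite lee_fin /C -/kappa [leRHS]mulrAC ler_wpM2r ?invr_ge0 ?(ltW kappa0)//.
  by have := ep_le _ _ kl; lra.
have [F mF tF] : exists2 F, measurable_fun setT F & {ae mu, forall x, cvg_coord t F x}.
  apply: (@L2_limit_exists _ _ mu t C (ltW C0) mt) => k.
  by under eq_integral do rewrite sqdist_sym; exact: cauchy.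
have [m pm] := pushforward_exists mu mF.
have mid := @measurable_id _ X setT.
(* Fatou in the second index of the Cauchy estimate, with [k] fixed. *)
have tkF k : \int[mu]_x (sqdist (t k x) (F x))%:E <= (C * ep k)%:E.
  apply: le_trans (fatou_sqdist mt mF (mt k) tF) _.
  by apply: (@limn_einf_le _ _ _ k) => l; exact: cauchy.
have Pm : P2 omega0 m.
  apply: (P2_pushforward hconv hmu nsc mF pm).
  apply: le_lt_trans (integral_sqdist_triangle mu (half_gt0 R) (half_gt0 R) (half_half R)
    mid (mt 0%N) mF) _.
  rewrite tW lte_add_pinfty// lte_mul_pinfty ?lee_fin ?invrK//.
    by rewrite (W2sq_lty hconv).
  by apply: le_lt_trans (tkF 0%N) _; rewrite ltry.
have Em : E m <= limn_einf (fun k => E (v k)).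
  apply: hlsc => //.
  apply: (@squeeze_cvge _ _ _ _ (cst 0) _ (fun k => (C * ep k)%:E)).
  - apply: nearW => k; rewrite W2sq_ge0/=; apply: le_trans (tkF k).
    by have [_ [pk _]] := ot k; exact: (W2sq_le (mt k) mF pk pm).
  - exact: cvg_cst.
  - apply: cvg_EFin; first exact: nearW.
    rewrite -(mulr0 C); apply: cvgMr; apply: cvg_expr.
    by rewrite ger0_norm ?invr_ge0// invf_lt1// ltr1n.
have Wm : W2sq mu m <= limn_einf (fun k => W2sq mu (v k)).
  apply: le_trans (W2sq_le mid mF (fun A mA => erefl) pm) _.
  apply: le_trans (fatou_sqdist mt mF mid tF) _.
  by rewrite (_ : (fun k => _) = (fun k => W2sq mu (v k)))//; apply/funext.
suff Phim : Phi m <= J%:E.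
  exists m; split; last by apply: le_lt_trans Phim _; rewrite ltry.
  by split => // c Pc; apply: le_trans Phim _; exact: JP.
rewrite leNgt; apply/negP => JPhi.
pose u := ((2 * tau)^-1)%R; have u0 : (0 < u)%R by rewrite invr_gt0 mulr_gt0.
pose w := fine (W2sq mu m).
(* A real [r] stands in for [E m], which may still be infinite here. *)
have [r rE Jr] : exists2 r : R, r%:E < E m & (J < u * w + r)%R.
  move: JPhi; rewrite /Phi (W2sq_fineE hmu Pm) -/w -/u; move: (E_gt Pm).
  case: (E m) => [e| |]// _; last by exists (J - u * w + 1)%R; [rewrite ltry|lra].
  rewrite -EFinM -EFinD lte_fin => H.
  by exists (e - (u * w + e - J) / 2)%R; rewrite ?lte_fin; lra.
pose de := (u * w + r - J)%R; have de0 : (0 < de)%R by rewrite /de; lra.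
have [N1 N1P] := lt_limn_einf (lt_le_trans rE Em).
(* The slack [de] is shared out: the distance term loses [de / 4] and the error [ep] less than
   [de / 2], so together they cannot fill it. *)
have : (w - de / (4 * u))%:E < W2sq mu m.
  by rewrite (W2sq_fineE hmu Pm) -/w lte_fin ltrBlDr ltrDl divr_gt0// mulr_gt0.
move=> /lt_le_trans/(_ Wm)/lt_limn_einf[N2 N2P].
have [N3 N3P] : exists N3, (ep N3 < de / 2)%R.
  have := @cvg_expr R 4^-1; rewrite ger0_norm ?invr_ge0// invf_lt1// ltr1n => /(_ isT).
  move=> /cvgrPdist_lt/(_ (de / 2)%R); rewrite divr_gt0// => /(_ isT)[N3 _ H].
  exists N3; have := H N3 (leqnn _) => /=.
  by rewrite sub0r normrN ger0_norm// exprn_ge0// invr_ge0.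
pose k := maxn N1 (maxn N2 N3).
have k1 : (N1 <= k)%N by exact: leq_maxl.
have k2 : (N2 <= k)%N by rewrite /k !leq_max leqnn orbT.
have k3 : (N3 <= k)%N by rewrite /k !leq_max leqnn !orbT.
have := N1P k k1; have := N2P k k2; have := ep_le _ _ k3; have := Phiv k.
rewrite /Phi (W2sq_fineE hmu (Pv k)) -/u.
move: (E_gt (Pv k)); case: (E (v k)) => [e| |]// _.
rewrite -EFinM -EFinD lee_fin !lte_fin => h1 h2 h3 h4.
have : (u * (w - de / (4 * u)) < u * fine (W2sq mu (v k)))%R by rewrite ltr_pM2l.
have -> : (u * (w - de / (4 * u)) = u * w - de / 4)%R by field; exact: lt0r_neq0.
by rewrite /de in N3P *; lra.
Qed.

End existence.
End prox.

(** * The intermediate point *)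

Section step.
Context {R : realType} {n : nat}.
Notation X := (Rd R n).
Notation P := (prob R n).
Local Open Scope ereal_scope.
Variables (tau h : R) (tau0 : (0 < tau)%R).

Lemma sqdist_step_base (t : X -> X) x :
  sqdist x (step_map tau h t x) = ((((tau - h) / tau) ^+ 2) * sqdist x (t x))%R.
Proof.
rewrite /sqdist mulr_sumr; apply: eq_bigr => i _; rewrite /step_map /of_vec /vec !mxE.
by field; exact: lt0r_neq0.
Qed.

Lemma sqdist_step_end (t : X -> X) x :
  sqdist (step_map tau h t x) (t x) = (((h / tau) ^+ 2) * sqdist x (t x))%R.
Proof.
rewrite /sqdist mulr_sumr; apply: eq_bigr => i _; rewrite /step_map /of_vec /vec !mxE.
by field; exact: lt0r_neq0.
Qed.

Lemma measurable_step_map (t : X -> X) : measurable_fun setT t ->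
  measurable_fun setT (step_map tau h t).
Proof. by move=> mt; exact: (measurable_comb _ _ mt (@measurable_id _ _ _)). Qed.

Variables (mu m nu : P) (t : X -> X).
Hypotheses (ot : ot_map mu m t) (pnu : is_pushforward mu (step_map tau h t) nu).

Lemma integral_step_base : \int[mu]_x (sqdist x (step_map tau h t x))%:E =
  (((tau - h) / tau) ^+ 2)%:E * W2sq mu m.
Proof.
have [mt [_ <-]] := ot.
rewrite -ge0_integralZl_EFin//.
- by apply: eq_integral => x _; rewrite sqdist_step_base EFinM.
- by move=> x _; rewrite lee_fin sqdist_ge0.
- exact: measurable_sqdistE.
- exact: sqr_ge0.
Qed.

Lemma W2sq_step_base : W2sq mu nu <= (((tau - h) / tau) ^+ 2)%:E * W2sq mu m.
Proof.
have [mt _] := ot; rewrite -integral_step_base.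
exact: (W2sq_le (@measurable_id _ _ _) (measurable_step_map mt) (fun A mA => erefl) pnu).
Qed.

Lemma W2sq_step_end : W2sq nu m <= ((h / tau) ^+ 2)%:E * W2sq mu m.
Proof.
have [mt [pt <-]] := ot.
rewrite -ge0_integralZl_EFin//.
- apply: le_trans (W2sq_le (measurable_step_map mt) mt pnu pt) _.
  by under [leLHS]eq_integral do rewrite sqdist_step_end EFinM.
- by move=> x _; rewrite lee_fin sqdist_ge0.
- exact: measurable_sqdistE.
- exact: sqr_ge0.
Qed.

(** At [h = tau] the weight [(tau - h) / tau] vanishes and cannot enter the weighted triangle
    inequality; this settles that case. *)
Lemma step_full_meq : h = tau -> meq nu mu.
Proof.
move=> ht A mA; rewrite pnu//; congr (mu _).
have -> : step_map tau h t = id; last by [].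
apply/funext => x; apply/rowP => i; rewrite /step_map /of_vec /vec ht !mxE.
by field; exact: lt0r_neq0.
Qed.

End step.

(** * The resolvent identity *)

Unset Implicit Arguments.

Theorem theorem2p3 (R : realType) (d : nat) (hd : (0 < d)%N)
  (omega0 : prob R d) (E : prob R d -> \bar R) (lam : R)
  (E_wd : forall mu nu : prob R d, meq mu nu -> E mu = E nu)
  (E_gt : forall mu : prob R d, P2 omega0 mu -> (-oo < E mu)%E)
  (hdom : dom_assumption omega0 E)
  (hproper : proper_functional omega0 E)
  (hcoer : coercive omega0 E)
  (hlsc : W2_lsc omega0 E)
  (hconv : convex_gen_geod omega0 E lam)
  (mu : prob R d) (hmu : P2 omega0 mu) (hmuE : (E mu < +oo)%E)
  (h tau : R) (hh : 0 < h) (hht : h <= tau)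
  (htau : lam_minus lam = 0 \/ tau < (lam_minus lam)^-1) :
  exists m : prob R d,
    is_prox omega0 E tau mu m /\
    (forall m', is_prox omega0 E tau mu m' -> meq m' m) /\
    (exists t, ot_map mu m t) /\
    forall t, ot_map mu m t ->
      (exists nu : prob R d, is_pushforward mu (step_map tau h t) nu) /\
      forall nu : prob R d, is_pushforward mu (step_map tau h t) nu ->
        forall n : prob R d, is_prox omega0 E h nu n <-> meq n m.
Proof.
have nsc : no_small_charge mu by exact: hdom.
have tau0 : 0 < tau by exact: lt_le_trans hht.
(* The bound on [tau] is exactly what makes the modulus positive. A vanishing [lam_minus lam] is
   treated apart, the inverse of 0 being 0 rather than infinity. *)
have kappa0 : 0 < tau^-1 + lam.
  have lm : - lam <= lam_minus lam by rewrite le_max lexx orbT.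
  have ti0 : 0 < tau^-1 by rewrite invr_gt0.
  case: htau => [l0|]; first by rewrite l0 in lm; lra.
  have : 0 <= lam_minus lam by rewrite le_max lexx.
  rewrite le_eqVlt => /orP[/eqP l0|l0]; first by rewrite -l0 in lm; lra.
  by rewrite -ltf_pV2 ?posrE ?invr_gt0// invrK; lra.
have [m [pm Phim]] := minimizer_exists hconv E_gt hmu nsc tau0 kappa0 hmuE hcoer hlsc.
have Pm := pm.1.
have uniq m' : is_prox omega0 E tau mu m' -> meq m' m.
  by move=> pm'; exact: (minimizer_unique hconv E_gt hmu nsc tau0 kappa0 pm pm').
exists m; split => //; split => //; split; first exact: (exists_ot_map hconv hmu nsc Pm).
move=> t ot; have [mt _] := ot.
have ms := measurable_step_map tau h mt.
split; first exact: pushforward_exists.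
move=> nu pnu n.
have fin a b := @W2sq_fineE _ _ _ _ _ hconv a b.
pose W := fine (W2sq mu m).
have Pnu : P2 omega0 nu.
  apply: (P2_pushforward hconv hmu nsc ms pnu).
  by rewrite (integral_step_base _ tau0 ot) (fin _ _ hmu Pm) -EFinM ltry.
pose th := h / tau.
have th0 : 0 < th by rewrite divr_gt0.
have th1 : (tau - h) / tau = 1 - th by rewrite mulrBl divff// lt0r_neq0.
have Em : exists e, E m = e%:E.
  move: Phim; rewrite (fin _ _ hmu Pm); move: (E_gt _ Pm).
  by case: (E m) => [e| |]//; exists e.
have {Em} [e Em] := Em.
(* Both bounds come from nu lying on a geodesic from mu to m, and from the
   weighted triangle inequality through nu. *)
have to_end : (2 * h)^-1 * fine (W2sq nu m) <= th * ((2 * tau)^-1 * W).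
  have := W2sq_step_end tau0 ot pnu.
  rewrite (fin _ _ hmu Pm) (fin _ _ Pnu Pm) -EFinM lee_fin -/W -/th => H.
  have -> : th * ((2 * tau)^-1 * W) = (2 * h)^-1 * (th ^+ 2 * W).
    by rewrite /th; field; rewrite !lt0r_neq0.
  by rewrite ler_wpM2l// invr_ge0 mulr_ge0// ltW.
have via_nu c : P2 omega0 c -> (2 * tau)^-1 * fine (W2sq mu c) <=
    (1 - th) * ((2 * tau)^-1 * W) + (2 * h)^-1 * fine (W2sq nu c).
  move=> Pc; move: hht; rewrite le_eqVlt => /orP[/eqP ht|ht].
    rewrite (meq_W2sq _ (step_full_meq tau0 pnu ht)) /th ht divff ?lt0r_neq0//.
    by rewrite subrr mul0r add0r.
  have s0 : 0 < 1 - th by rewrite subr_gt0 ltr_pdivrMr// mul1r.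
  (* With weights [1 - th] and [th], the factor [(1 - th)^-1] cancels against the square in
     [W2sq_step_base], and [(2 * tau)^-1 * th^-1] is [(2 * h)^-1]. *)
  have := W2sq_triangle hconv hmu Pnu Pc s0 th0 (subrK _ _).
  have := W2sq_step_base tau0 ot pnu.
  rewrite (fin _ _ hmu Pm) (fin _ _ hmu Pnu) (fin _ _ hmu Pc) (fin _ _ Pnu Pc).
  rewrite -!EFinM -EFinD !lee_fin -/W th1 => H1 H2.
  have -> : (1 - th) * ((2 * tau)^-1 * W) + (2 * h)^-1 * fine (W2sq nu c) =
    (2 * tau)^-1 * ((1 - th)^-1 * ((1 - th) ^+ 2 * W) + th^-1 * fine (W2sq nu c)).
    rewrite expr2 !mulrA mulVf ?lt0r_neq0// mul1r /th; field.
    by rewrite !lt0r_neq0.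
  rewrite ler_wpM2l ?invr_ge0 ?mulr_ge0 ?(ltW tau0)//.
  by apply: le_trans H2 _; rewrite lerD2r ler_wpM2l// invr_ge0 ltW.
(* Inserting [via_nu] into the minimality of [m] removes the share [1 - th] of [W / (2 * tau)];
   [to_end] bounds the distance term of [m] by the remaining share [th]. *)
have proxm : is_prox omega0 E h nu m.
  split => // c Pc; have := pm.2 c Pc; have := via_nu c Pc; move: to_end.
  rewrite Em (fin _ _ hmu Pm) (fin _ _ hmu Pc) (fin _ _ Pnu Pm) (fin _ _ Pnu Pc) -/W.
  move: (E_gt _ Pc); case: (E c) => [ec| |]// _; last by rewrite addey ?leey.
  by rewrite -!EFinM -!EFinD !lee_fin /=; lra.
split=> [pn|nm].
  (* The same two bounds, with the minimality of [n] between them, show that [n] does at least as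
     well as [m] from [mu], so uniqueness applies. *)
  have [Pn nmin] := pn; apply: uniq; split => // c Pc.
  apply: le_trans (pm.2 c Pc); have := nmin m Pm; have := via_nu n Pn; move: to_end.
  rewrite Em (fin _ _ hmu Pm) (fin _ _ hmu Pn) (fin _ _ Pnu Pm) (fin _ _ Pnu Pn) -/W.
  move: (E_gt _ Pn); case: (E n) => [en| |]// _.
  by rewrite -!EFinM -!EFinD !lee_fin /=; lra.
split; first by rewrite /P2 (meq_W2sq _ nm).
move=> c Pc; rewrite (E_wd _ _ nm) (W2sq_sym nu n) (meq_W2sq _ nm) (W2sq_sym m nu).
exact: proxm.2.
Qed.
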